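(* Let $X$ be a zero-mean real-valued random variable, let $U$ be uniformly distributed on $[0,1]$ and independent of $X$, and let $\mathsf{r}$ be the reciprocating function of $X$, $U_X$ the associated randomization variable and $Y:=|X\,\mathsf{r}(X,U_X)|$ (all defined in the context). Then: (i) There exist an event $\Omega_0\in\Sigma$ such that $\mathsf{P}(\Omega_0)=1$ and continuous functions $\tilde c\colon\tilde V_0\to(-\infty,0]$ and $\tilde d\colon\tilde V_0\to[0,\infty)$ defined on the set $\tilde V_0:=\{Y(\omega)\colon\omega\in\Omega_0\}$ such that $\tilde d$ and $-\tilde c$ are nondecreasing on $\tilde V_0$, and on $\Omega_0$ one has $$\{X,\mathsf{r}(X,U_X)\}=\{\tilde c(Y),\tilde d(Y)\}\quad\text{and}\quad -\tilde c(Y)\,\tilde d(Y)=Y.$$ (ii) With $\Omega_0,\tilde V_0,\tilde c,\tilde d$ as in (i), for every $y\in\tilde V_0$ let $\tilde D_y$ be a random variable such that, if $y\neq0$, $$\tilde D_y=\begin{cases}\tilde d(y) & \text{with probability }\frac{|\tilde c(y)|}{|\tilde c(y)|+\tilde d(y)},\\ \tilde c(y) & \text{with probability }\frac{\tilde d(y)}{|\tilde c(y)|+\tilde d(y)},\end{cases}$$ and $\tilde D_0\equiv0$; thus $\tilde D_y$ takes on at most two distinct values and $\mathsf{E}\tilde D_y=0$. Then the conditional distribution of $X$ given $Y$ coincides with that of $\tilde D_Y$, in the following sense: for all Borel functions $F\colon\mathbb{R}\times\mathbb{R}\to[0,\infty)$, $$\mathsf{E}F(X,Y)=\int_{\mathbb{R}}\mathsf{P}(Y\in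 dy)\,\mathsf{E}F(\tilde D_y,y);$$ here one can write $\int_{[0,\infty)}$ instead of $\int_{\mathbb{R}}$.
   Context: $X$ is a zero-mean real-valued random variable (so $\mathsf{E}|X|<\infty$, $\mathsf{E}X=0$) on a probability space $(\Omega,\Sigma,\mathsf{P})$; $\mathbf{I}\{\cdot\}$ denotes the indicator. Define $$G(x):=\begin{cases}\mathsf{E}X\,\mathbf{I}\{X\in(0,x]\} & \text{if } x\in[0,\infty],\\ \mathsf{E}(-X)\,\mathbf{I}\{X\in[x,0)\} & \text{if } x\in[-\infty,0],\end{cases}$$ and $m:=G(\infty)=G(-\infty)=\frac12\mathsf{E}|X|<\infty$. For $h\in[0,m]$ let $$x_+(h):=\inf\{x\in[0,\infty]\colon G(x)\ge h\},\qquad x_-(h):=\sup\{x\in[-\infty,0]\colon G(x)\ge h\}.$$ For $x\in\mathbb{R}$ and $u\in[0,1]$ let $$H(x,u):=\begin{cases}G(x-)+u\,(G(x)-G(x-)) & \text{if } x\in[0,\infty),\\ G(x+)+u\,(G(x)-G(x+)) & \text{if } x\in(-\infty,0],\end{cases}$$ where $G(x\mp)$ are one-sided limits ($G$ is continuous at $0$ with $G(0)=0$, so the two lines agree at $x=0$). The reciprocating function of $X$ is $$\mathsf{r}(x,u):=\begin{cases}x_-(H(x,u)) & \text{if } x\in[0,\infty),\\ x_+(H(x,u)) & \text{if } x\in(-\infty,0].\end{cases}$$ $U\colon\Omega\to\mathbb{R}$ is uniformly distributed on $[0,1]$ and independent of $X$. For real $x$, $U_x:=U$ if $\mathsf{P}(X=x)\neq0$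 and $U_x:=1$ if $\mathsf{P}(X=x)=0$; and $U_X(\omega):=U_{X(\omega)}(\omega)$. Finally $Y:=|X\,\mathsf{r}(X,U_X)|$. The variable $\tilde D_y$ is defined for $y\in\tilde V_0$, and $Y\in\tilde V_0$ on $\Omega_0$; values of integrands outside $\tilde V_0$ play no role.
   Formalization: Continuity of c̃ and d̃ at the point 0 of Ṽ₀ is not claimed when P(X=0)>0 and the law of X off 0 accumulates at 0 from exactly one side, where the printed claim is false; continuity on Ṽ₀∖{0} is always claimed. *)

(* Defs.v *)
From HB Require Import structures.
From mathcomp Require Export all_boot all_order all_algebra.
From mathcomp Require Export all_classical all_reals all_analysis.
From mathcomp Require Export measurable_realfun.
Export Order.TTheory GRing.Theory Num.Theory.
Export numFieldNormedType.Exports.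

Set Implicit Arguments.
Unset Strict Implicit.
Unset Printing Implicit Defensive.

Local Open Scope classical_set_scope.
Local Open Scope ring_scope.

(* [fine] is harmless for an integrable [X]: both expectations are then finite.
   At [x = 0] both formulas give 0. *)
Definition recG d (T : measurableType d) (R : realType) (P : probability T R)
    (X : T -> R) (x : \bar R) : R :=
  if (0 <= x)%E
  then fine ('E_P[fun w => X w * \1_[set v | 0 < X v /\ ((X v)%:E <= x)%E] w])
  else fine ('E_P[fun w => - X w * \1_[set v | (x <= (X v)%:E)%E /\ X v < 0] w]).

Definition xplus d (T : measurableType d) (R : realType) (P : probability T R)
    (X : T -> R) (h : R) : \bar R :=
  ereal_inf [set x : \bar R | (0 <= x)%E /\ h <= recG P X x].

Definition xminus d (T : measurableType d) (R : realType) (P : probability T R)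
    (X : T -> R) (h : R) : \bar R :=
  ereal_sup [set x : \bar R | (x <= 0)%E /\ h <= recG P X x].

Definition recH d (T : measurableType d) (R : realType) (P : probability T R)
    (X : T -> R) (x u : R) : R :=
  if 0 <= x
  then let Gl := lim (recG P X t%:E @[t --> x^'-]) in
       Gl + u * (recG P X x%:E - Gl)
  else let Gr := lim (recG P X t%:E @[t --> x^'+]) in
       Gr + u * (recG P X x%:E - Gr).

(* The value may be infinite, but only for exceptional [(x, u)]. *)
Definition recip d (T : measurableType d) (R : realType) (P : probability T R)
    (X : T -> R) (x u : R) : \bar R :=
  if 0 <= x then xminus P X (recH P X x u) else xplus P X (recH P X x u).

(* The variable written [U_X]. *)
Definition Urand d (T : measurableType d) (R : realType) (P : probability T R)
    (X U : T -> R) (w : T) : R :=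
  if P (X @^-1` [set X w]) == 0%E then 1 else U w.

Definition recipX d (T : measurableType d) (R : realType) (P : probability T R)
    (X U : T -> R) (w : T) : \bar R :=
  recip P X (X w) (Urand P X U w).

Definition absprod d (T : measurableType d) (R : realType) (P : probability T R)
    (X U : T -> R) (w : T) : \bar R :=
  `| (X w)%:E * recipX P X U w |%E.

Definition zero_mean d (T : measurableType d) (R : realType)
    (P : probability T R) (X : T -> R) : Prop :=
  P.-integrable [set: T] (EFin \o X) /\ ('E_P[X] = 0)%E.

Definition uniform01 d (T : measurableType d) (R : realType)
    (P : probability T R) (U : {RV P >-> R}) : Prop :=
  forall A : set R, measurable A ->
    distribution P U A = uniform_prob (@ltr01 R) A.

Definition independent_RV d (T : measurableType d) (R : realType)
    (P : probability T R) (X U : T -> R) : Prop :=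
  forall A B : set R, measurable A -> measurable B ->
    P (X @^-1` A `&` U @^-1` B) = (P (X @^-1` A) * P (U @^-1` B))%E.

(* The set of (finite) values of [absprod] on [O]. *)
Definition valuesY d (T : measurableType d) (R : realType)
    (P : probability T R) (X U : T -> R) (O : set T) : set R :=
  [set y | exists2 w, O w & absprod P X U w = y%:E].

(* [X] has an atom at 0 and the rest of its law accumulates at 0 from exactly
   one side. In this case alone [c] and [d] below cannot both be continuous at
   the point 0 of [valuesY P X U O]. For instance, let
   [P(X = 0) = 1/2], [P(X = 1) = 1/6], and let [X] be uniform on [[-1, 0)] with
   the remaining probability [1/3]. Then [recip] is 0 at [x = 0] and 1 at every
   [x] in [(-1, 0)], so that [d 0 = 0], while [d y = 1] for values [y = |X|]
   arbitrarily close to 0, whatever the event [O] of probability 1. *)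
Definition one_sided_at0 d (T : measurableType d) (R : realType)
    (P : probability T R) (X : T -> R) : Prop :=
  (0 < P (X @^-1` [set 0%R]))%E /\
  ~ ((forall e : R, 0 < e -> (0 < P (X @^-1` `]0%R, e[))%E) <->
     (forall e : R, 0 < e -> (0 < P (X @^-1` `](- e)%R, 0%R[))%E)).

(* [c] and [d] matter only on [valuesY P X U O]. The last clause makes
   [absprod] finite on [O]. *)
Record disintegrating_pair d (T : measurableType d) (R : realType)
    (P : probability T R) (X U : T -> R) (O : set T) (c d : R -> R) : Prop :=
  DisintegratingPair {
    dp_event : measurable O /\ P O = 1%E ;
    dp_sign : forall y, valuesY P X U O y -> c y <= 0 /\ 0 <= d y ;
    dp_continuous : {within valuesY P X U O `\ 0, continuous c} /\
                    {within valuesY P X U O `\ 0, continuous d} ;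
    dp_continuous0 : ~ one_sided_at0 P X ->
                     {within valuesY P X U O, continuous c} /\
                     {within valuesY P X U O, continuous d} ;
    dp_monotone : forall y z, valuesY P X U O y -> valuesY P X U O z ->
                  y <= z -> - c y <= - c z /\ d y <= d z ;
    dp_pair : forall w, O w ->
      [set (X w)%:E; recipX P X U w] =
      [set (c (fine (absprod P X U w)))%:E; (d (fine (absprod P X U w)))%:E] ;
    dp_prod : forall w, O w ->
      (- c (fine (absprod P X U w)) * d (fine (absprod P X U w)))%:E =
      absprod P X U w
  }.

(* [D] stands for the variable attached to [y], with [c = c y] and [d = d y]. *)
Definition two_point d (T : measurableType d) (R : realType)
    (P : probability T R) (y c d : R) (D : T -> R) : Prop :=
  (y != 0 ->
     P (D @^-1` [set d]) = (`|c| / (`|c| + d))%:E /\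
     P (D @^-1` [set c]) = (d / (`|c| + d))%:E) /\
  (y = 0 -> forall w, D w = 0).

(* Main.v *)
From HB Require Import structures.
From mathcomp Require Import ring.
Require Import Defs.
Set Implicit Arguments.
Unset Strict Implicit.
Unset Printing Implicit Defensive.
Local Open Scope classical_set_scope.
Local Open Scope ring_scope.

(** Let [S = H(X, U_X)] be the level of [G] reached by the randomized variable, and
    let [b(h) = x_+(h)] and [a(h) = - x_-(h)] be the quantiles of [G] on the two
    sides of zero.

    The randomization spreads each atom of [X] uniformly over the jump of [G] that
    it causes, so under the measure [X^+ dP] the level [S] is uniform on [[0, m]]
    ([posmass_lev_lt]). The same statement for [- X] says that [S] is uniform under
    [X^- dP], on the same interval because [E X = 0]. Hence
    [E f(S) X^+ = E f(S) X^-] for every Borel [f >= 0] ([rlevel_law]), and this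
    exchange is the whole reason why [X] is balanced given [Y].

    Comparing masses, uniformity also shows that almost surely [X = b(S)] where
    [X > 0] and [X = - a(S)] where [X < 0] ([quant_lev]). So, apart from [X = 0],
    the pair formed by [X] and [r(X, U_X)] consists of [b(S)] and [- a(S)], and
    [Y = a(S) b(S)] ([good_cases], [absprod_neq0]). Both factors are
    positive and nondecreasing in the level, so the product determines the factors
    ([le_quantiles_of_qprod]) and they become nondecreasing functions of [Y]. When
    [y] is the product of two nondecreasing nonnegative functions of [y], neither can
    grow faster than the product allows, so both are locally Lipschitz away from
    0 ([factor_pair_lipschitz]). Continuity at 0 is a separate matter, decided by
    whether the law of [X] accumulates at 0 on both sides, on one or on none
    ([dtilde_nctilde_cvg0]).

    For the conditional law, where [X > 0] one has [X^+ / b(S) = 1], and where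
    [X < 0] one has [X^- / a(S) = 1]. Both sides of the formula thus become sums
    [E u(S) X^+ + E v(S) X^-], up to the same term on [X = 0], and by the exchange
    only [u + v] matters ([integral_levels]). The two values of [u + v] agree because
    the weights of the two-valued variable are proportional to [1 / b] and [1 / a]
    ([expectation_disintegration]). The argument applies to every admissible pair
    of functions, since signs force it to agree with [- a(S)] and [b(S)] almost
    surely ([pair_good]). *)

(** * Preliminaries on measurability and null sets *)

Lemma nondecreasing_emeasurable (R : realType) (f : R -> \bar R) :
  (forall x y, x <= y -> (f x <= f y)%E) -> measurable_fun [set: R] f.
Proof.
move=> fnd; apply: (measurability (@ErealGenCInfty.G R)) => [|/= _ [_] [r] -> <-].
  exact: ErealGenCInfty.measurableE.
rewrite setTI; apply: is_interval_measurable => s t /=.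
rewrite !in_itv/= !andbT => fs ft u /andP[su ut].
by rewrite in_itv/= andbT (le_trans fs)// fnd.
Qed.

Lemma measurable_fun_div d (T : measurableType d) (R : realType) (f g : T -> R) :
  measurable_fun [set: T] f -> measurable_fun [set: T] g ->
  (forall x, 0 <= g x) -> measurable_fun [set: T] (fun x => f x / g x).
Proof.
move=> mf mg g0.
rewrite (_ : (fun x => f x / g x) = f \* (fun x => g x `^ (-1))).
  by apply: measurable_funM => //; exact: measurableT_comp (measurable_powR _) mg.
by apply/funext => x /=; rewrite powR_inv1.
Qed.

Lemma probability_ae1 d (T : measurableType d) (R : realType)
    (P : probability T R) (A : set T) : measurable A -> {ae P, forall w, A w} ->
  P A = 1%E.
Proof.
move=> mA [N [mN N0 subN]].
have : P (~` A) = 0%E.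
  by apply: subset_measure0 N0 => //; exact: measurableC.
rewrite probability_setC// => /eqP.
by rewrite sube_eq ?fin_num_measure// ?add0e// => /eqP.
Qed.

(** The running supremum is monotone on the whole line, hence Borel, whatever [A]
    is. It can be infinite above [A], where [fine] makes it harmless. This is what
    makes integrands living on the image [valuesY] of an event measurable, since
    that image need not be a Borel set. *)
Lemma monotone_extension (R : realType) (A : set R) (f : R -> R) :
  (forall y z, A y -> A z -> y <= z -> f y <= f z) ->
  exists2 g : R -> R, measurable_fun [set: R] g & forall y, A y -> g y = f y.
Proof.
move=> fnd; pose G y : \bar R := ereal_sup [set (f z)%:E | z in A `&` [set z | z <= y]].
have Gnd : measurable_fun [set: R] G.
  apply: nondecreasing_emeasurable => x y xy; apply: ge_ereal_sup => _ [z [Az /= zx] <-].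
  by apply: ereal_sup_ubound; exists z => //; split => //=; exact: le_trans zx xy.
exists (fine \o G); first exact: measurableT_comp.
move=> y Ay /=; rewrite (_ : G y = (f y)%:E)//; apply/eqP; rewrite eq_le.
apply/andP; split.
  apply: ge_ereal_sup => _ [z [Az /= zy] <-].
  by rewrite lee_fin fnd.
by apply: ereal_sup_ubound; exists y => //; split => /=.
Qed.

(** * The mass of the positive part *)

Section positive_mass.
Context d (T : measurableType d) (R : realType) (P : probability T R).
Variable X : {RV P >-> R}.

(** The measure [X^+ dP]; applied to [\- X] it is [X^- dP]. *)
Definition posmass (A : set T) : \bar R := (\int[P]_(w in A) (X^\+ w)%:E)%E.

Let mXp : measurable_fun [set: T] (fun w => (X^\+ w)%:E).
Proof. exact/measurable_EFinP. Qed.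

Let Xp_ge0 w : (0 <= (X^\+ w)%:E)%E.
Proof. by rewrite lee_fin funrpos_ge0. Qed.

Let posmass0 : posmass set0 = 0%E.
Proof. by rewrite /posmass integral_set0. Qed.

Let posmass_ge0 A : (0 <= posmass A)%E.
Proof. exact: integral_ge0. Qed.

Let posmass_sigma_additive : semi_sigma_additive posmass.
Proof. exact: semi_sigma_additive_nng_induced. Qed.

HB.instance Definition _ := isMeasure.Build _ _ _ posmass
  posmass0 posmass_ge0 posmass_sigma_additive.

Lemma posmass_dominates : posmass `<< P.
Proof.
apply/null_content_dominatesP => A mA PA0.
by rewrite /posmass null_set_integral//; exact: measurable_funTS.
Qed.

Lemma posmass_ae (A B : set T) : measurable A -> measurable B ->
  {ae P, forall w, 0 < X w -> A w <-> B w} -> posmass A = posmass B.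
Proof.
move=> mA mB AB; rewrite /posmass integral_mkcond [RHS]integral_mkcond.
apply: ge0_ae_eq_integral => //.
- by apply/measurable_restrict => //; rewrite setTI; exact: measurable_funTS.
- by apply/measurable_restrict => //; rewrite setTI; exact: measurable_funTS.
- by move=> w _; rewrite patchE; case: ifP.
- by move=> w _; rewrite patchE; case: ifP.
apply: filterS AB => w AB _; rewrite !patchE.
have [Xw|Xw] := ltP 0 (X w); last by rewrite /funrpos max_r//; do 2 case: ifP.
have -> // : (w \in A) = (w \in B).
by apply/idP/idP; rewrite !inE => /AB; exact.
Qed.

Lemma posmass_sub0 (A : set T) : measurable A -> (forall w, A w -> X w <= 0) ->
  posmass A = 0%E.
Proof.
move=> mA A0; rewrite (@posmass_ae A set0)// ?measure0//.
by apply: nearW => w X0; split => // /A0; rewrite leNgt X0.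
Qed.

Hypothesis iX : P.-integrable [set: T] (EFin \o X).

Lemma integrable_posmass : P.-integrable [set: T] (fun w => (X^\+ w)%:E).
Proof.
apply: (le_integrable measurableT _ _ iX) => // w _ /=.
by rewrite lee_fin ger0_norm ?funrpos_ge0// /funrpos ge_max ler_norm normr_ge0.
Qed.

Lemma posmass_fin A : measurable A -> posmass A \is a fin_num.
Proof.
move=> mA; apply: integrable_fin_num => //.
exact: (integrableS measurableT _ _ integrable_posmass).
Qed.

(** [X^+] is the Radon-Nikodym derivative of its own induced measure, so this is
    the change of variables formula for that derivative. *)
Lemma integral_posmass (f : T -> \bar R) : measurable_fun [set: T] f ->
  (forall w, (0 <= f w)%E) ->
  (\int[posmass]_w f w = \int[P]_w (f w * (X^\+ w)%:E))%E.
Proof.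
move=> mf f0.
have finite : fin_num_fun posmass by move=> A mA; exact: posmass_fin.
pose mfin := Measure_isFinite.Build _ _ _ posmass finite.
pose nu : {finite_measure set T -> \bar R} := HB.pack posmass mfin.
have nuP : nu `<< P by exact: posmass_dominates.
rewrite -[LHS](@Radon_Nikodym_SigmaFinite.change_of_variables _ _ _ nu P nuP)//.
have mRN := measurable_int _ (Radon_Nikodym_SigmaFinite.f_integrable nuP).
apply: ge0_ae_eq_integral => //.
- exact: emeasurable_funM.
- exact: emeasurable_funM.
- by move=> w _; rewrite mule_ge0// Radon_Nikodym_SigmaFinite.f_ge0.
- by move=> w _; rewrite mule_ge0.
have : ae_eq P setT (Radon_Nikodym_SigmaFinite.f nu P) (fun w => (X^\+ w)%:E).
  apply: integral_ae_eq => //.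
    exact: Radon_Nikodym_SigmaFinite.f_integrable.
  by move=> A _ mA; rewrite -Radon_Nikodym_SigmaFinite.f_integral.
by apply: filterS => w /= ->.
Qed.

(** [G(x)], [G(x-)] and [m], for [x >= 0]. *)
Definition cumle (x : R) : R := fine (posmass [set w | X w <= x]).
Definition cumlt (x : R) : R := fine (posmass [set w | X w < x]).
Definition total : R := fine (posmass [set: T]).

(** [H(x, u)] for [x >= 0]: the atom at [x], if any, is spread linearly over the
    jump of [G] at [x]. *)
Definition level (x u : R) : R := cumlt x + u * (cumle x - cumlt x).

Lemma measurable_RVle x : measurable [set w | X w <= x].
Proof.
rewrite (_ : mkset _ = X @^-1` `]-oo, x]); first exact: measurable_funPTI.
by apply/seteqP; split => w; rewrite /= in_itv.
Qed.

Lemma measurable_RVlt x : measurable [set w | X w < x].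
Proof.
rewrite (_ : mkset _ = X @^-1` `]-oo, x[); first exact: measurable_funPTI.
by apply/seteqP; split => w; rewrite /= in_itv.
Qed.

Hint Resolve measurable_RVle measurable_RVlt : core.

Lemma le_posmass A B : measurable A -> measurable B -> A `<=` B ->
  fine (posmass A) <= fine (posmass B).
Proof.
move=> mA mB AB; rewrite fine_le ?posmass_fin//.
by apply: le_measure => //; rewrite inE.
Qed.

Lemma cumleE x : (cumle x)%:E = posmass [set w | X w <= x].
Proof. by rewrite /cumle fineK// posmass_fin. Qed.

Lemma cumltE x : (cumlt x)%:E = posmass [set w | X w < x].
Proof. by rewrite /cumlt fineK// posmass_fin. Qed.

Lemma totalE : total%:E = posmass setT.
Proof. by rewrite /total fineK// posmass_fin. Qed.

Lemma le_cumle x y : x <= y -> cumle x <= cumle y.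
Proof. by move=> xy; apply: le_posmass => // w /= /le_trans; exact. Qed.

Lemma le_cumlt x y : x <= y -> cumlt x <= cumlt y.
Proof. by move=> xy; apply: le_posmass => // w /= /lt_le_trans; exact. Qed.

Lemma cumlt_le_cumle x : cumlt x <= cumle x.
Proof. by apply: le_posmass => // w /= /ltW. Qed.

Lemma cumle_le_cumlt x y : x < y -> cumle x <= cumlt y.
Proof. by move=> xy; apply: le_posmass => // w /= /le_lt_trans; exact. Qed.

Lemma cumle_le_total x : cumle x <= total.
Proof. exact: le_posmass. Qed.

Lemma cumle_npos x : x <= 0 -> cumle x = 0.
Proof.
move=> x0; rewrite /cumle posmass_sub0// => w /= /le_trans; exact.
Qed.

Lemma cumlt_npos x : x <= 0 -> cumlt x = 0.
Proof.
by move=> x0; rewrite /cumlt posmass_sub0// => w /= /ltW /le_trans; exact.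
Qed.

Lemma cumle_ge0 x : 0 <= cumle x. Proof. exact: fine_ge0. Qed.
Lemma cumlt_ge0 x : 0 <= cumlt x. Proof. exact: fine_ge0. Qed.
Lemma total_ge0 : 0 <= total. Proof. exact: fine_ge0. Qed.

Lemma level_ge0 x u : 0 <= u -> 0 <= level x u.
Proof.
by move=> u0; rewrite addr_ge0 ?cumlt_ge0// mulr_ge0// subr_ge0 cumlt_le_cumle.
Qed.

Lemma cumlt_le_level x u : 0 <= u -> cumlt x <= level x u.
Proof. by move=> u0; rewrite lerDl mulr_ge0// subr_ge0 cumlt_le_cumle. Qed.

Lemma level_le_cumle x u : u <= 1 -> level x u <= cumle x.
Proof.
by move=> u1; rewrite -lerBrDl ler_piMl// subr_ge0 cumlt_le_cumle.
Qed.

Lemma cvg_cumlt x : cumle (x - n.+1%:R^-1) @[n --> \oo] --> cumlt x.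
Proof.
rewrite /cumlt; apply: fine_cvg; rewrite fineK ?posmass_fin//.
pose F n := [set w | X w <= x - n.+1%:R^-1].
have -> : [set w | X w < x] = \bigcup_n F n.
  apply/seteqP; split => w /=; last first.
    by move=> [n _]; rewrite /F /= => /le_lt_trans; apply; rewrite ltrBlDr ltrDl invr_gt0 ltr0n.
  rewrite -subr_gt0 => /ltr_add_invr[n].
  by rewrite add0r => nX; exists n => //; rewrite /F /= lerBrDr -lerBrDl ltW.
apply: nondecreasing_cvg_mu => //.
- by apply: bigcupT_measurable => n; exact: measurable_RVle.
- move=> m n mn; apply/subsetPset => w; rewrite /F /= => /le_trans; apply.
  by rewrite lerD2l lerN2 lef_pV2 ?posrE ?ltr0n// ler_nat.
Qed.

Lemma cvg_cumle x : cumle (x + n.+1%:R^-1) @[n --> \oo] --> cumle x.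
Proof.
rewrite {2}/cumle; apply: fine_cvg; rewrite fineK ?posmass_fin//.
pose F n := [set w | X w <= x + n.+1%:R^-1].
have -> : [set w | X w <= x] = \bigcap_n F n.
  apply/seteqP; split => w /=.
    by move=> Xx n _; rewrite /F /= (le_trans Xx)// lerDl.
  rewrite /F /= => FX; apply/ler_addgt0Pl => e e0; rewrite addrC.
  have [n ne] := ltr_add_invr e0.
  apply: le_trans (FX n I) _; rewrite lerD2l ltW//.
  by move: ne; rewrite add0r.
apply: nonincreasing_cvg_mu => //.
- by rewrite -ge0_fin_numE// posmass_fin.

- by apply: bigcapT_measurable => n; exact: measurable_RVle.
- move=> m n mn; apply/subsetPset => w; rewrite /F /= => /le_trans; apply.
  by rewrite lerD2l lef_pV2 ?posrE ?ltr0n// ler_nat.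
Qed.

Lemma cvg_total : cumle n%:R @[n --> \oo] --> total.
Proof.
rewrite /total; apply: fine_cvg; rewrite fineK ?posmass_fin//.
pose F n := [set w | X w <= n%:R].
have -> : [set: T] = \bigcup_n F n.
  apply/seteqP; split => w //= _; exists (Num.truncn (X w)).+1 => //; rewrite /F /=.
  by rewrite ltW// truncnS_gt.
apply: nondecreasing_cvg_mu => //.
- by apply: bigcupT_measurable => n; exact: measurable_RVle.
- by move=> m n mn; apply/subsetPset => w; rewrite /F /= => /le_trans; apply; rewrite ler_nat.
Qed.

Lemma cumle_right x h : (forall y, x < y -> h <= cumle y) -> h <= cumle x.
Proof.
move=> H; apply: (cvgr_to_ge (cvg_cumle (x:=x))).
by apply: nearW => n; apply: H; rewrite ltrDl.
Qed.

Lemma cumlt_left x h : (forall y, y < x -> cumle y <= h) -> cumlt x <= h.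
Proof.
move=> H; apply: (cvgr_to_le (cvg_cumlt (x:=x))).
by apply: nearW => n; apply: H; rewrite ltrBlDr ltrDl.
Qed.

Lemma total_sup h : (forall y, 0 <= y -> cumle y <= h) -> total <= h.
Proof.
move=> H; apply: (cvgr_to_le cvg_total).
by apply: nearW => n; apply: H; rewrite ler0n.
Qed.

End positive_mass.

(** * Quantiles of the mass *)

Section one_sided_limits.
Context d (T : measurableType d) (R : realType) (P : probability T R).
Variables (X : {RV P >-> R}) (iX : P.-integrable [set: T] (EFin \o X)).

Lemma cumle_at_left x : cumle X t @[t --> x^'-] --> cumlt X x.
Proof.
apply/cvgrPdist_le => e e0.
have /cvgrPdist_le/(_ _ e0)[n _ /(_ n (leqnn n))/= ne] := cvg_cumlt iX (x := x).
near=> t.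
have tx : t < x by near: t; exact: nbhs_left_lt.
rewrite ger0_norm ?subr_ge0; last exact: cumle_le_cumlt.
apply: le_trans ne; rewrite ger0_norm; last first.
  by rewrite subr_ge0 cumle_le_cumlt// ltrBlDr ltrDl.
rewrite lerD2l lerN2 le_cumle//; near: t; apply: nbhs_left_ge.
by rewrite ltrBlDr ltrDl.
Unshelve. all: by end_near. Qed.

Lemma cumle_at_right x : cumle X t @[t --> x^'+] --> cumle X x.
Proof.
apply/cvgrPdist_le => e e0.
have /cvgrPdist_le/(_ _ e0)[n _ /(_ n (leqnn n))/= ne] := cvg_cumle iX (x := x).
near=> t.
have tx : x < t by near: t; exact: nbhs_right_gt.
rewrite ler0_norm ?subr_le0; last by rewrite le_cumle// ltW.
apply: le_trans ne; rewrite ler0_norm; last first.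
  by rewrite subr_le0 le_cumle// lerDl.
rewrite lerN2 lerD2l lerN2 le_cumle//; near: t; apply: nbhs_right_le.
by rewrite ltrDl.
Unshelve. all: by end_near. Qed.

End one_sided_limits.

Section quantile.
Context d (T : measurableType d) (R : realType) (P : probability T R).
Implicit Type X : {RV P >-> R}.

Definition ecum X (x : \bar R) : R := fine (posmass X [set w | (X w)%:E <= x]%E).

(** [x_+(h)] when read for [X], and [- x_-(h)] when read for [\- X]. *)
Definition quant X (h : R) : \bar R :=
  ereal_inf [set x : \bar R | (0 <= x)%E /\ h <= ecum X x].

Lemma integrable_opp X : P.-integrable [set: T] (EFin \o X) ->
  P.-integrable [set: T] (EFin \o (\- X : {RV P >-> R})).
Proof.
by move=> iX; apply: eq_integrable (integrableN iX) => // w _ /=; rewrite EFinN.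
Qed.

Lemma quant_ge0 X h : (0 <= quant X h)%E.
Proof. by apply: le_ereal_inf_tmp => x [/=]. Qed.

Lemma le_quant X h k : h <= k -> (quant X h <= quant X k)%E.
Proof.
move=> hk; apply: ereal_inf_le_tmp => x [/= x0 kx]; split => //.
exact: le_trans kx.
Qed.

(** The Galois connection between a right-continuous monotone function and its
    generalized inverse. All later use of quantiles goes through it. *)
Lemma quant_le X (iX : P.-integrable [set: T] (EFin \o X)) h t : 0 <= t ->
  (quant X h <= t%:E)%E = (h <= cumle X t).
Proof.
move=> t0; apply/idP/idP => [qt|ht]; last first.
  by apply: ereal_inf_lbound; split; rewrite ?lee_fin.
apply: (cumle_right iX) => y ty.
have : (quant X h < y%:E)%E by apply: le_lt_trans qt _; rewrite lte_fin.
move=> /ereal_inf_lt[[x||]/= [x0 hx]]; last 2 first.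
  by rewrite ltNge leey.
  by move: x0; rewrite leNgt ltNy0.
by rewrite lte_fin => /ltW/(le_cumle iX); exact: le_trans.
Qed.

Lemma quant_gt0 X (iX : P.-integrable [set: T] (EFin \o X)) h :
  (0 < quant X h)%E = (0 < h).
Proof. by rewrite ltNge quant_le// cumle_npos// -ltNge. Qed.

Lemma quant_lty X (iX : P.-integrable [set: T] (EFin \o X)) h :
  h < total X -> (quant X h < +oo)%E.
Proof.
move=> hm; have [y [y0 hy]] : exists y, 0 <= y /\ h <= cumle X y.
  apply: contrapT => H; move: hm; rewrite ltNge => /negP; apply.
  apply: (total_sup iX) => y y0; rewrite leNgt; apply/negP => /ltW hy.
  by apply: H; exists y.
by apply: (@le_lt_trans _ _ y%:E); rewrite ?ltry// quant_le.
Qed.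

End quantile.

(** * The reciprocating function in terms of masses of X and -X *)

Section reciprocating_function.
Context d (T : measurableType d) (R : realType) (P : probability T R).
Variables (X : {RV P >-> R}) (iX : P.-integrable [set: T] (EFin \o X)).
Local Notation X' := (\- X : {RV P >-> R}).
Let iX' : P.-integrable [set: T] (EFin \o X') := integrable_opp iX.

Lemma expectation_posmass (Y : {RV P >-> R}) (f : T -> R) (A : set T) :
  measurable A ->
  (forall w, f w = (Y^\+ w) * \1_A w) -> ('E_P[f] = posmass Y A)%E.
Proof.
move=> mA fE; rewrite unlock /posmass [RHS]integral_mkcond.
apply: eq_integral => w _; rewrite fE patchE indicE.
by case: ifP => _; rewrite ?mulr1 ?mulr0.
Qed.

Let mset_le (Y : {RV P >-> R}) (x : \bar R) : measurable [set w | (Y w)%:E <= x]%E.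
Proof.
rewrite -[X in measurable X]setTI; apply: emeasurable_fun_infty_c => //.
exact/measurable_EFinP.
Qed.

Lemma recG_ge0 (x : \bar R) : (0 <= x)%E -> recG P X x = ecum X x.
Proof.
move=> x0; rewrite /recG x0 (@expectation_posmass X _ [set w | (X w)%:E <= x]%E)//.
move=> w; rewrite !indicE /funrpos; have [Xw|Xw] := leP (X w) 0.
  rewrite mul0r memNset ?mulr0// => -[/=].
  by rewrite ltNge Xw.
congr (_ * _%:R); congr (nat_of_bool _); apply/idP/idP; rewrite !inE /=.
  by case.
by move=> ?; split.
Qed.

(** On the negative half-line [G] is the mass of [\- X] on the positive one, so
    that statements about [X > 0] apply to both sides of zero. *)
Lemma recG_le0 (x : \bar R) : (x <= 0)%E -> recG P X x = ecum X' (- x)%E.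
Proof.
rewrite le_eqVlt => /orP[/eqP ->|x0].
  rewrite recG_ge0// oppe0 /ecum !posmass_sub0// => w /=; by rewrite lee_fin.
rewrite /recG leNgt x0/=.
rewrite (@expectation_posmass X' _ [set w | (X' w)%:E <= - x]%E)//.
move=> w; rewrite !indicE /funrpos /=; have [Xw|Xw] := leP (- X w) 0.
  rewrite mul0r memNset ?mulr0// => -[/= _].
  by rewrite -oppr_gt0 ltNge Xw.
congr (_ * _%:R); congr (nat_of_bool _); apply/idP/idP; rewrite !inE /=.
  by case => xX _; rewrite EFinN leeN2.
by rewrite EFinN leeN2 -oppr_gt0.
Qed.

Lemma recG_cumle x : 0 <= x -> recG P X x%:E = cumle X x.
Proof. by move=> x0; rewrite recG_ge0. Qed.

Lemma recG_cumleN x : x <= 0 -> recG P X x%:E = cumle X' (- x).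
Proof. by move=> x0; rewrite recG_le0. Qed.

Lemma xplusE h : xplus P X h = quant X h.
Proof.
rewrite /xplus /quant; congr ereal_inf.
by apply/seteqP; split => x [/= x0]; rewrite ?recG_ge0// => ?; split; rewrite ?recG_ge0.
Qed.

Lemma xminusE h : xminus P X h = (- quant X' h)%E.
Proof.
rewrite /quant /ereal_inf oppeK; congr ereal_sup.
apply/seteqP; split => x /=.
  move=> [x0]; rewrite recG_le0// => hx; exists (- x)%E; rewrite ?oppeK//.
  by split => //; rewrite oppe_ge0.
by move=> [y [y0 hy] <-]; rewrite recG_le0 ?oppeK// oppe_le0.
Qed.

(** At [x = 0] the limit from the left runs through the other branch of [G]; it
    vanishes because the mass of [\- X] has no atom at 0. *)
Lemma recH_ge0 x u : 0 <= x -> recH P X x u = level X x u.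
Proof.
move=> x0; rewrite /recH x0 recG_cumle//.
suff -> : lim (recG P X t%:E @[t --> x^'-]) = cumlt X x by [].
move: x0; rewrite le_eqVlt => /orP[/eqP <-|x0]; last first.
  apply/cvg_lim => //.
  apply: cvg_trans (cumle_at_left iX (x := x)); apply: near_eq_cvg; near=> t.
  by rewrite recG_cumle//; near: t; exact: nbhs_left_ge.
rewrite cumlt_npos//; apply/cvg_lim => //.
have : cumle X' t @[t --> 0^'+] --> cumle X' 0 by exact: cumle_at_right.
rewrite cumle_npos// => /cvg_at_rightNP; rewrite oppr0; apply: cvg_trans.
apply: near_eq_cvg; near=> t => /=.
by rewrite recG_cumleN//; near: t; exact: nbhs_left_le.
Unshelve. all: by end_near. Qed.

Lemma recH_lt0 x u : x < 0 -> recH P X x u = level X' (- x) u.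
Proof.
move=> x0; rewrite /recH leNgt x0/= recG_cumleN; last exact: ltW.
suff -> : lim (recG P X t%:E @[t --> x^'+]) = cumlt X' (- x) by [].
apply/cvg_lim => //; apply/cvg_at_rightNP.
apply: cvg_trans (cumle_at_left iX' (x := - x)); apply: near_eq_cvg; near=> t => /=.
rewrite recG_cumleN ?opprK//; rewrite oppr_le0; near: t; apply: nbhs_left_ge.
by rewrite oppr_gt0.
Unshelve. all: by end_near. Qed.

End reciprocating_function.

(** * Uniformity of the randomized level *)

Section randomizer.
Context d (T : measurableType d) (R : realType) (P : probability T R).
Implicit Types (X U : {RV P >-> R}) (V : T -> R).

(** All that is used of [U_X]: at an atom of [X] it is uniform given [X], and
    elsewhere only its range matters. Unlike [Urand] itself, this is visibly
    invariant under [X |-> - X]. *)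
Record randomizer X V : Prop := Randomizer {
  rand_measurable : measurable_fun [set: T] V;
  rand01 : {ae P, forall w, 0 <= V w <= 1};
  rand_atom : forall q a, 0 <= a <= 1 -> P (X @^-1` [set q]) != 0%E ->
    P (X @^-1` [set q] `&` [set w | V w < a]) = (P (X @^-1` [set q]) * a%:E)%E
}.

Lemma uniform01_lt U a : uniform01 U -> 0 <= a <= 1 ->
  P (U @^-1` `]-oo, a[) = a%:E.
Proof.
move=> hU /andP[a0 a1].
have -> : P (U @^-1` `]-oo, a[) = uniform_prob (@ltr01 R) `]-oo, a[.
  by rewrite -hU.
rewrite /uniform_prob integral_uniform_pdf.
have -> : `]-oo, a[%classic `&` `[0, 1]%classic = `[0, a[%classic :> set R.
  apply/seteqP; split => x /=; rewrite !in_itv/=.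
    by move=> [-> /andP[-> _]].
  by move=> /andP[-> xa]; rewrite xa (le_trans (ltW xa)).
rewrite (eq_integral (fun=> 1%E)); last first.
  move=> x; rewrite inE/= in_itv/= => /andP[x0 xa].
  by rewrite /uniform_pdf x0 (le_trans (ltW xa))//= subr0 invr1.
rewrite integral_cst//= mul1e lebesgue_measure_itv/= lte_fin.
move: a0; rewrite le_eqVlt => /orP[/eqP <-|->]; first by rewrite ltxx.
by rewrite oppr0 adde0.
Qed.

Lemma uniform01_ae U : uniform01 U -> {ae P, forall w, 0 <= U w <= 1}.
Proof.
move=> hU; exists (U @^-1` (~` `[0, 1]%classic)); split.
- by apply: measurable_funPTI; exact: measurableC.
- have -> : P (U @^-1` (~` `[0, 1]%classic)) = uniform_prob (@ltr01 R) (~` `[0, 1]%classic).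
    by rewrite -hU//; exact: measurableC.
  rewrite /uniform_prob integral_uniform_pdf.
  by rewrite setICl integral_set0.
- by move=> w /=; rewrite in_itv.
Qed.

(** [P (X = x)] is the measure of the section at [x] of the diagonal of the plane. *)
Lemma measurable_atom X : measurable_fun [set: R] (fun x => P (X @^-1` [set x])).
Proof.
pose D : set (R * R) := [set z | z.1 = z.2].
have mD : measurable D.
  rewrite (_ : D = setT `&` (fun z : R * R => z.1 - z.2) @^-1` [set 0]).
    exact: measurable_funB.
  rewrite setTI; apply/seteqP; split => z; rewrite /D /=.
    by move=> ->; rewrite subrr.
  by move=> /subr0_eq.
have := @measurable_fun_xsection _ _ _ _ _ (distribution P X) D mD.
congr (measurable_fun _ _); apply/funext => x /=.
rewrite /distribution /pushforward; congr (P _).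
by apply/seteqP; split => w; rewrite /xsection /D /= inE /=.
Qed.

Lemma Urand_randomizer X U : uniform01 U -> independent_RV P X U ->
  randomizer X (Urand P X U).
Proof.
move=> hU hXU; split.
- apply: measurable_fun_ifT => //.
  apply: measurable_fun_eqe => //.
  exact: (measurableT_comp (measurable_atom X)).
- apply: filterS (uniform01_ae hU) => w Uw; rewrite /Urand.
  by case: ifP => // _; rewrite ler01 lexx.
- move=> q a a01 Pq0.
  have -> : X @^-1` [set q] `&` [set w | Urand P X U w < a] =
      X @^-1` [set q] `&` U @^-1` `]-oo, a[.
    apply/seteqP; split => w [/= Xq]; rewrite in_itv/= /Urand Xq (negbTE Pq0)//.
  by rewrite hXU// uniform01_lt.
Qed.

Lemma randomizer_opp X V : randomizer X V ->
  randomizer (\- X : {RV P >-> R}) V.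
Proof.
move=> [mV V01 VX]; split => // q a a01.
have -> : (\- X : {RV P >-> R}) @^-1` [set q] = X @^-1` [set (- q)].
  apply/seteqP; split => w /= => [<-|->]; by rewrite opprK.
exact: VX.
Qed.

End randomizer.

Section uniformity.
Context d (T : measurableType d) (R : realType) (P : probability T R).
Variables (X : {RV P >-> R}) (iX : P.-integrable [set: T] (EFin \o X)).
Variables (V : T -> R) (hV : randomizer X V).

Definition lev (w : T) : R := level X (X w) (V w).

Lemma measurable_lev : measurable_fun [set: T] lev.
Proof.
have mlt : measurable_fun [set: T] (cumlt X \o X).
  apply: measurableT_comp => //; apply: nondecreasing_measurable => // x y.
  exact: le_cumlt.
have mle : measurable_fun [set: T] (cumle X \o X).
  apply: measurableT_comp => //; apply: nondecreasing_measurable => // x y.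
  exact: le_cumle.
apply: measurable_funD => //; apply: measurable_funM.
  exact: rand_measurable hV.
exact: measurable_funB.
Qed.

Lemma measurable_lev_lt h : measurable [set w | lev w < h].
Proof.
rewrite -[X in measurable X]setTI (_ : mkset _ = lev @^-1` `]-oo, h[).
  exact: measurable_lev.
by apply/seteqP; split => w; rewrite /= in_itv.
Qed.

Lemma measurable_lev_le h : measurable [set w | lev w <= h].
Proof.
rewrite -[X in measurable X]setTI (_ : mkset _ = lev @^-1` `]-oo, h]).
  exact: measurable_lev.
by apply/seteqP; split => w; rewrite /= in_itv.
Qed.

Hint Resolve measurable_lev_lt measurable_lev_le : core.

Let lev01 : {ae P, forall w, [/\ 0 <= lev w, cumlt X (X w) <= lev w &
  lev w <= cumle X (X w)]}.
Proof.
apply: filterS (rand01 hV) => w /andP[V0 V1]; split.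
- exact: level_ge0.
- exact: cumlt_le_level.
- exact: level_le_cumle.
Qed.

Lemma posmass_atom q A : 0 <= q -> measurable A -> A `<=` X @^-1` [set q] ->
  posmass X A = (q%:E * P A)%E.
Proof.
move=> q0 mA AX; rewrite /posmass (eq_integral (cst q%:E)) ?integral_cst//.
by move=> w /[!inE] /AX /= Xq; rewrite /funrpos Xq max_l.
Qed.

(** With [q] the quantile of [h], the level is below [h] left of [q] and at least
    [h] right of [q]. At [X = q] the event [lev < h] is [V < a], where [a] is the
    fraction of the jump of [G] at [q] lying below [h], so uniformity of [V] gives
    exactly the missing mass [h - G(q-)]. If [G] stays below
    [h], then [h] is the total mass and almost every level is below it. *)
Lemma posmass_lev_lt_total h : 0 <= h <= total X ->
  posmass X [set w | lev w < h] = h%:E.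
Proof.
move=> /andP[h0 hm].
have [[y [y0 hy]]|big] := pselect (exists y, 0 <= y /\ h <= cumle X y); last first.
  have lth y : 0 <= y -> cumle X y < h.
    by move=> y0; rewrite ltNge; apply/negP => hy; apply: big; exists y.
  have -> : h = total X.
    apply/eqP; rewrite eq_le hm/=; apply: (total_sup iX) => y y0.
    exact/ltW/lth.
  rewrite totalE//; apply: posmass_ae => //.
  apply: filterS lev01 => w [_ _ le] X0; split => // _.
  apply: le_lt_trans le _; apply: lt_le_trans (lth _ (ltW X0)) _.
  exact: hm.
have qy : (quant X h <= y%:E)%E by rewrite quant_le.
have qfin : quant X h \is a fin_num.
  by rewrite ge0_fin_numE ?quant_ge0// (le_lt_trans qy)// ltry.
pose q := fine (quant X h).
have qE : quant X h = q%:E by rewrite fineK.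
have q0 : 0 <= q by rewrite fine_ge0// quant_ge0.
have hq : h <= cumle X q by rewrite -quant_le// qE.
have ltq x : 0 <= x -> x < q -> cumle X x < h.
  by move=> x0 xq; rewrite ltNge -quant_le// qE lee_fin -ltNge.
have qh : cumlt X q <= h.
  apply: (cumlt_left iX) => x xq; have [x0|x0] := ltP x 0.
    by rewrite cumle_npos// ltW.
  exact/ltW/ltq.
pose p := cumle X q - cumlt X q.
have mXq : measurable (X @^-1` [set q]) by exact: measurable_funPTI.
pose A := X @^-1` [set q] `&` [set w | lev w < h].
have mA : measurable A by exact: measurableI.
have pE : (p%:E = posmass X (X @^-1` [set q]))%E.
  rewrite EFinB cumleE// (_ : [set w | X w <= q] =
      X @^-1` [set q] `|` [set w | X w < q]).
    rewrite measureU//; last 2 first.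
      exact: measurable_RVlt.
      by apply/seteqP; split => w //= [->]; rewrite ltxx.
    by rewrite cumltE// addeK// posmass_fin//; exact: measurable_RVlt.
  apply/seteqP; split => w /=; rewrite le_eqVlt.
    by move=> /orP[/eqP|]; [left|right].
  by move=> [->|->]; rewrite ?eqxx ?orbT.
have AE : posmass X A = (h - cumlt X q)%:E.
  have p0 : 0 <= p by rewrite subr_ge0 cumlt_le_cumle.
  move: p0; rewrite le_eqVlt => /orP[/eqP p0|p0].
    have -> : h - cumlt X q = 0.
      apply/eqP; rewrite eq_le subr_ge0 qh andbT subr_le0 (le_trans hq)//.
      by rewrite -subr_le0 -/p -p0.
    apply/eqP; rewrite -measure_le0 (_ : 0%E = posmass X (X @^-1` [set q])).
      by apply: le_measure; rewrite ?inE//; exact: subIsetl.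
    by rewrite -pE -p0.
  (* The fraction of the jump at [q] that lies below [h]. *)
  pose a := (h - cumlt X q) / p.
  have a01 : 0 <= a <= 1.
    apply/andP; split; first by apply: divr_ge0; [rewrite subr_ge0|exact: ltW].
    by rewrite ler_pdivrMr// mul1r lerD2r.
  have AV : A = X @^-1` [set q] `&` [set w | V w < a].
    apply/seteqP; split => w [/= Xq] => [levh|Va]; split => //=.
      by move: levh; rewrite /lev /level Xq -ltrBrDl /a ltr_pdivlMr.
    by rewrite /lev /level Xq -ltrBrDl -ltr_pdivlMr.
  have Pq0 : P (X @^-1` [set q]) != 0%E.
    apply/eqP => Pq0; move: pE; rewrite (posmass_atom q0)// Pq0 mule0.
    by move=> -[p0']; rewrite p0' ltxx in p0.
  rewrite (posmass_atom q0)//; last exact: subIsetl.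
  rewrite AV (rand_atom hV)// muleA -(posmass_atom q0)// -pE -EFinM.
  by rewrite /a mulrC divfK// gt_eqF.
transitivity (posmass X ([set w | X w < q] `|` A)).
  apply: posmass_ae => //.
    by apply: measurableU => //; exact: measurable_RVlt.
  apply: filterS lev01 => w [_ ltlev levle] X0; split => /=.
    have [Xq|qX|Xq] := ltgtP (X w) q; [by left| |by right].
    rewrite ltNge => /negP[]; apply: le_trans ltlev.
    exact: le_trans hq (cumle_le_cumlt iX qX).
  by move=> [Xq|[]//]; apply: le_lt_trans levle _; apply: ltq => //; exact: ltW.
rewrite measureU//; last 2 first.
  exact: measurable_RVlt.
  by apply/seteqP; split => w //= -[Xq [/= Xq' _]]; rewrite Xq' ltxx in Xq.
transitivity ((cumlt X q)%:E + (h - cumlt X q)%:E)%E.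
  by rewrite cumltE// -AE.
by rewrite -EFinD addrC subrK.
Qed.

(** This is the distribution function of the uniform measure on [[0, total X]] of
    density 1. *)
Lemma posmass_lev_lt h :
  posmass X [set w | lev w < h] = (Num.max 0 (Num.min h (total X)))%:E.
Proof.
have m0 := total_ge0 X.
have [h0|h0] := ltP h 0.
  rewrite min_l ?max_l ?(ltW h0)//; last by rewrite (le_trans (ltW h0)).
  transitivity (posmass X set0); last exact: measure0.
  apply: posmass_ae => //.
  apply: filterS lev01 => w [l0 _ _] X0; split => //=.
  by rewrite ltNge (le_trans (ltW h0)).
have [hm|mh] := leP h (total X).
  by rewrite max_r// posmass_lev_lt_total// h0.
rewrite max_r// totalE//; apply: posmass_ae => //.
apply: filterS lev01 => w [_ _ le] X0; split => //= _.
apply: le_lt_trans mh; exact: le_trans le (cumle_le_total iX _).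
Qed.

Lemma posmass_eq0 A : measurable A -> posmass X A = 0%E ->
  {ae P, forall w, 0 < X w -> ~ A w}.
Proof.
move=> mA A0; have : ae_eq P A (fun w => (X^\+ w)%:E) (cst 0%E).
  apply/ae_eq_integral_abs => //.
    by apply: measurable_funTS; exact/measurable_EFinP.
  rewrite -A0 /posmass; apply: eq_integral => w _.
  by rewrite gee0_abs// lee_fin funrpos_ge0.
apply: filterS => w /[swap] X0 /[apply] /= -[].
by rewrite /funrpos max_l ?ltW// => X00; rewrite X00 ltxx in X0.
Qed.

Lemma posmass_le_lev h : 0 <= h -> (posmass X [set w | (lev w <= h)%R] <= h%:E)%E.
Proof.
move=> h0; apply/lee_addgt0Pr => e e0; rewrite -EFinD.
apply: (@le_trans _ _ (posmass X [set w | lev w < h + e])).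
  by apply: le_measure; rewrite ?inE// => w /= /le_lt_trans; apply; rewrite ltrDl.
rewrite posmass_lev_lt lee_fin ge_max ge_min lexx/= andbT.
by rewrite addr_ge0// ltW.
Qed.

Lemma lev_gt0 : {ae P, forall w, 0 < X w -> 0 < lev w}.
Proof.
have : {ae P, forall w, 0 < X w -> ~ (lev w <= 0)}.
  apply: (@posmass_eq0 [set w | lev w <= 0]) => //.
  by apply/eqP; rewrite -measure_le0 posmass_le_lev.
by apply: filterS => w + X0 => /(_ X0)/negP; rewrite -ltNge.
Qed.

Lemma lev_lt_total : {ae P, forall w, 0 < X w -> lev w < total X}.
Proof.
have : {ae P, forall w, 0 < X w -> ~ (~` [set w | lev w < total X]) w}.
  apply: posmass_eq0; first exact: measurableC.
  rewrite -setTD measureD//; last by rewrite -ge0_fin_numE// posmass_fin.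
  by rewrite setTI/= -totalE// posmass_lev_lt_total ?lexx ?total_ge0// subee.
by apply: filterS => w + X0 => /(_ X0)/contrapT.
Qed.

(** From [lev w <= G(X w)] follows [quant X (lev w) <= X w]. For the converse, compare
    masses: up to a null set, [{X <= t}] is contained in [{lev <= G(t)}], and by
    uniformity both have
    mass [G(t)], so their difference is null. Rational [t] suffice to separate
    [quant X (lev w)] from [X w]. *)
Lemma quant_lev : {ae P, forall w, 0 < X w -> quant X (lev w) = (X w)%:E}.
Proof.
have null t : 0 <= t ->
    {ae P, forall w, 0 < X w -> ~ ([set w | lev w <= cumle X t] `\`
      [set w | X w <= t]) w}.
  move=> t0; apply: posmass_eq0.
    by apply: measurableD => //; exact: measurable_RVle.
  apply/eqP; rewrite -measure_le0 measureD//; last 2 first.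
    exact: measurable_RVle.
    by rewrite -ge0_fin_numE// posmass_fin.
  rewrite /=.
  have -> : posmass X ([set w | lev w <= cumle X t] `&` [set w | X w <= t]) =
      (cumle X t)%:E.
    rewrite cumleE//; apply: posmass_ae.
    - by apply: measurableI => //; exact: measurable_RVle.
    - exact: measurable_RVle.
    apply: filterS lev01 => w [_ _ le] X0; split => [[]//|Xt]; split => //=.
    exact: le_trans le (le_cumle iX Xt).
  by rewrite leeBlDr// add0e posmass_le_lev// cumle_ge0.
(* Nonnegative rationals, enumerated; undefined codes default to 0. *)
pose r n : R := `|ratr (odflt 0%Q (unpickle n))|.
have : {ae P, forall w n, 0 < X w -> lev w <= cumle X (r n) -> X w <= r n}.
  apply: ae_foralln => n.
  have := null (r n) (normr_ge0 _).
  apply: filterS => w + X0 lw => /(_ X0) H.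
  by apply: contrapT => Xr; apply: H.
apply: filterS2 lev01 => w [l0 _ le] H X0.
apply/eqP; rewrite eq_le quant_le ?le ?(ltW X0)//=.
rewrite leNgt; apply/negP => qX.
have qfin : quant X (lev w) \is a fin_num.
  by rewrite ge0_fin_numE ?quant_ge0// (lt_trans qX)// ltry.
have q0 : 0 <= fine (quant X (lev w)) by rewrite fine_ge0// quant_ge0.
have : fine (quant X (lev w)) < X w by rewrite -lte_fin fineK.
move=> /rat_in_itvoo[t]; rewrite in_itv/= => /andP[qt tX].
have rE : r (pickle t) = ratr t.
  by rewrite /r pickleK/= ger0_norm// ltW// (le_lt_trans q0).
have := H (pickle t) X0; rewrite rE => Ht; move: tX; rewrite ltNge Ht//.
rewrite -quant_le//; last by rewrite ltW// (le_lt_trans q0).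
by rewrite -(fineK qfin) lee_fin ltW.
Qed.

End uniformity.

(** * Exchange between the two sides of zero *)

Section level_law.
Context d (T : measurableType d) (R : realType) (P : probability T R).
Variables (X : {RV P >-> R}) (hX : zero_mean P X).
Variables (V : T -> R) (hV : randomizer X V).
Local Notation X' := (\- X : {RV P >-> R}).

Let iX : P.-integrable [set: T] (EFin \o X) := hX.1.
Let iX' : P.-integrable [set: T] (EFin \o X') := integrable_opp iX.
Let hV' : randomizer X' V := randomizer_opp hV.

(** This is what [E X = 0] says about the two sides of zero. *)
Lemma total_opp : total X' = total X.
Proof.
have : (\int[P]_w ((X^\+ w)%:E - (X'^\+ w)%:E) = 0)%E.
  case: hX => _; rewrite unlock => EX; rewrite -[RHS]EX.
  apply: eq_integral => w _; rewrite -EFinB /funrpos /=; congr EFin.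
  have [X0|X0] := leP (X w) 0.
    by rewrite max_l ?oppr_ge0// opprK add0r.
  by rewrite max_r ?subr0// oppr_le0 ltW.
rewrite integralB_EFin//; last 2 first.
- exact: integrable_posmass iX.
- exact: integrable_posmass iX'.
move=> /eqP; rewrite -[X in (X - _)%E]/(posmass X setT).
rewrite -[X in (_ - X)%E]/(posmass X' setT) -(totalE iX) -(totalE iX').
by rewrite -EFinB eqe subr_eq0 => /eqP.
Qed.

Definition rlevel (w : T) : R := recH P X (X w) (V w).

Lemma rlevel_gt0 w : 0 < X w -> rlevel w = lev X V w.
Proof. by move=> X0; rewrite /rlevel recH_ge0// ltW. Qed.

Lemma rlevel_lt0 w : X w < 0 -> rlevel w = lev X' V w.
Proof. by move=> X0; rewrite /rlevel recH_lt0. Qed.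

Lemma rlevel_eq0 w : X w = 0 -> rlevel w = 0.
Proof.
move=> X0; rewrite /rlevel recH_ge0 ?X0// /level cumlt_npos// cumle_npos//.
by rewrite subrr mulr0 addr0.
Qed.

Lemma measurable_rlevel : measurable_fun [set: T] rlevel.
Proof.
rewrite (_ : rlevel = fun w => if 0 <= X w then lev X V w else lev X' V w).
  apply: measurable_fun_ifT.
  - exact: measurable_fun_ler.
  - exact: measurable_lev.
  - exact: measurable_lev.
apply/funext => w; case: ifPn => [X0|]; last by rewrite -ltNge => /rlevel_lt0.
by rewrite /rlevel recH_ge0.
Qed.

(** Both [X^+ dP] and [X^- dP] push forward under the level to the uniform law on
    [[0, total X]]. This exchange replaces all integration over levels. *)
Lemma rlevel_law (f : R -> \bar R) : measurable_fun [set: R] f ->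
  (forall h, 0 <= f h)%E ->
  (\int[P]_w (f (rlevel w) * (X^\+ w)%:E) =
   \int[P]_w (f (rlevel w) * (X'^\+ w)%:E))%E.
Proof.
move=> mf f0.
have mfS : measurable_fun [set: T] (f \o rlevel).
  exact: measurableT_comp mf measurable_rlevel.
have fS0 w : (0 <= (f \o rlevel) w)%E by exact: f0.
rewrite -[LHS](integral_posmass iX mfS fS0) -[RHS](integral_posmass iX' mfS fS0).
pose mixS := isMeasurableFun.Build _ _ _ _ _ measurable_rlevel.
pose S : {mfun T >-> R} := HB.pack rlevel mixS.
have pushE (Y : {RV P >-> R}) :
    (\int[posmass Y]_w f (rlevel w) = \int[pushforward (posmass Y) S]_h f h)%E.
  by rewrite ge0_integral_pushforward// preimage_setT.
rewrite !pushE; apply: eq_measure_integral => A mA _.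
have mS h : measurable [set w | rlevel w < h].
  rewrite -[X in measurable X]setTI (_ : mkset _ = rlevel @^-1` `]-oo, h[).
    exact: measurable_rlevel.
  by apply/seteqP; split => w; rewrite /= in_itv.
have massS (Y : {RV P >-> R}) h :
    pushforward (posmass Y) S `]-oo, h[ = posmass Y [set w | rlevel w < h].
  by rewrite /pushforward; congr (posmass Y _).
apply: (@measure_unique _ _ R (@RGenInftyO.G R) (fun n => `]-oo, n%:R[%classic)) => //.
- exact: RGenInftyO.measurableE.
- move=> _ _ [x ->] [y ->]; exists (Num.min x y).
  by apply/seteqP; split => z; rewrite /= !in_itv/= lt_min => /andP.
- by move=> n; exists n%:R.
- apply/seteqP; split => x //= _; exists (Num.truncn x).+1 => //=.
  by rewrite in_itv/= truncnS_gt.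
- move=> _ [h ->]; transitivity (posmass X [set w | lev X V w < h]).
    rewrite -[LHS]/(pushforward (posmass X) S _) massS.
    apply: posmass_ae => //; first exact: measurable_lev_lt.
    by apply: nearW => w X0; rewrite /= rlevel_gt0.
  rewrite posmass_lev_lt// -total_opp -(posmass_lev_lt iX' hV').
  rewrite -[RHS]/(pushforward (posmass X') S _) massS.
  apply: posmass_ae => //; first exact: measurable_lev_lt.
  by apply: nearW => w X0; rewrite /= rlevel_lt0// -oppr_gt0.
- move=> n; rewrite -[X in (X < _)%E]/(pushforward (posmass X) S _) massS -ge0_fin_numE//.
  exact: posmass_fin.
Qed.

(** Almost every point is of this kind, and on such points everything is a
    function of the level and of the sign of [X]. *)
Record good_event (w : T) : Prop := GoodEvent {
  good_pos : 0 < X w -> 0 < rlevel w < total X /\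
    quant X (rlevel w) = (X w)%:E;
  good_neg : X w < 0 -> 0 < rlevel w < total X /\
    quant X' (rlevel w) = (- X w)%:E }.

Lemma good_event_ae : {ae P, forall w, good_event w}.
Proof.
have H (Y : {RV P >-> R}) (iY : P.-integrable [set: T] (EFin \o Y))
    (hY : randomizer Y V) : {ae P, forall w, 0 < Y w ->
      0 < lev Y V w < total Y /\ quant Y (lev Y V w) = (Y w)%:E}.
  apply: filterS3 (lev_gt0 iY hY) (lev_lt_total iY hY) (quant_lev iY hY).
  by move=> w l0 lm q Y0; rewrite l0// lm// q.
apply: filterS2 (H X iX hV) (H X' iX' hV') => w HX HX'; split => X0.
  by rewrite rlevel_gt0//; exact: HX.
rewrite rlevel_lt0// -total_opp; apply: HX'.
by rewrite oppr_gt0.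
Qed.

Lemma measurable_quant_rlevel (Y : {RV P >-> R}) :
  measurable_fun [set: T] (fun w => quant Y (rlevel w)).
Proof.
apply: measurableT_comp measurable_rlevel.
by apply: nondecreasing_emeasurable => x y; exact: le_quant.
Qed.

Lemma measurable_good_event : measurable [set w | good_event w].
Proof.
have mS : measurable [set w | 0 < rlevel w < total X].
  rewrite -[X in measurable X]setTI (_ : mkset _ = rlevel @^-1` `]0, total X[).
    exact: measurable_rlevel.
  by apply/seteqP; split => w; rewrite /= in_itv.
have mq (Y : {RV P >-> R}) : measurable [set w | quant Y (rlevel w) = (Y w)%:E].
  rewrite -[X in measurable X]setTI; apply: measurable_eqe => //.
    exact: measurable_quant_rlevel.
  exact/measurable_EFinP.
have -> : [set w | good_event w] =
    ([set w | X w <= 0] `|` ([set w | 0 < rlevel w < total X] `&`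
       [set w | quant X (rlevel w) = (X w)%:E])) `&`
    ([set w | X' w <= 0] `|` ([set w | 0 < rlevel w < total X] `&`
       [set w | quant X' (rlevel w) = (X' w)%:E])).
  apply/seteqP; split => w.
    move=> [gp gn]; split => /=.
      by have [X0|X0] := leP (X w) 0; [left|right; exact: gp].
    have [X0|X0] := leP (- X w) 0; [by left|right; apply: gn].
    by rewrite -oppr_gt0.
  move=> [/= gp gn]; split => X0.
    by case: gp => //; rewrite leNgt X0.
  by case: gn => //; rewrite leNgt oppr_gt0 X0.
apply: measurableI; apply: measurableU.
- exact: measurable_RVle.
- by apply: measurableI => //; exact: mq.
- exact: measurable_RVle.
- by apply: measurableI => //; exact: mq.
Qed.

(** Real values of the two quantiles. They are faithful below [total X]; elsewhere
    [fine] may turn an infinite quantile into 0, but the level takes such values with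
    probability 0. *)
Definition qplus (h : R) : R := fine (quant X h).
Definition qminus (h : R) : R := fine (quant X' h).

Lemma quant_fin (Y : {RV P >-> R}) (iY : P.-integrable [set: T] (EFin \o Y)) h :
  h < total Y -> quant Y h = (fine (quant Y h))%:E.
Proof.
by move=> hm; rewrite fineK// ge0_fin_numE ?quant_ge0// quant_lty.
Qed.

Lemma qplusE h : h < total X -> quant X h = (qplus h)%:E.
Proof. exact: quant_fin. Qed.

Lemma qminusE h : h < total X -> quant X' h = (qminus h)%:E.
Proof. by rewrite -total_opp; exact: quant_fin. Qed.

Lemma qplus_gt0 h : 0 < h < total X -> 0 < qplus h.
Proof. by move=> /andP[h0 hm]; rewrite -lte_fin -qplusE// quant_gt0. Qed.

Lemma qminus_gt0 h : 0 < h < total X -> 0 < qminus h.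
Proof. by move=> /andP[h0 hm]; rewrite -lte_fin -qminusE// quant_gt0. Qed.

Lemma le_qplus h k : h <= k -> k < total X -> qplus h <= qplus k.
Proof.
move=> hk km; rewrite -lee_fin -!qplusE//; first exact: le_quant.
exact: le_lt_trans km.
Qed.

Lemma le_qminus h k : h <= k -> k < total X -> qminus h <= qminus k.
Proof.
move=> hk km; rewrite -lee_fin -!qminusE//; first exact: le_quant.
exact: le_lt_trans km.
Qed.

Lemma measurable_qplus : measurable_fun [set: R] qplus.
Proof.
apply: measurableT_comp => //.
by apply: nondecreasing_emeasurable => x y; exact: le_quant.
Qed.

Lemma measurable_qminus : measurable_fun [set: R] qminus.
Proof.
apply: measurableT_comp => //.
by apply: nondecreasing_emeasurable => x y; exact: le_quant.
Qed.

Lemma recipE w : recip P X (X w) (V w) =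
  if 0 <= X w then (- quant X' (rlevel w))%E else quant X (rlevel w).
Proof. by rewrite /recip xplusE// xminusE//. Qed.

Lemma recip_eq0 w : X w = 0 -> recip P X (X w) (V w) = 0%E.
Proof.
move=> X0; rewrite recipE rlevel_eq0// X0 lexx.
apply/eqP; rewrite oppe_eq0 eq_le quant_ge0 andbT.
by rewrite (quant_le iX')// cumle_ge0.
Qed.

Lemma recip_gt0 w : good_event w -> 0 < X w ->
  [/\ 0 < rlevel w < total X, X w = qplus (rlevel w) &
      recip P X (X w) (V w) = (- qminus (rlevel w))%:E].
Proof.
move=> [gp _] X0; have [/[dup] S0m /andP[_ Sm] qX] := gp X0; split => //.
  by apply/EFin_inj; rewrite -qplusE.
by rewrite recipE ltW// qminusE.
Qed.

Lemma recip_lt0 w : good_event w -> X w < 0 ->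
  [/\ 0 < rlevel w < total X, X w = - qminus (rlevel w) &
      recip P X (X w) (V w) = (qplus (rlevel w))%:E].
Proof.
move=> [_ gn] X0; have [/[dup] S0m /andP[_ Sm] qX] := gn X0; split => //.
  by apply/oppr_inj/EFin_inj; rewrite opprK -qminusE.
by rewrite recipE leNgt X0/= qplusE.
Qed.

Lemma measurable_recip : measurable_fun [set: T] (fun w => recip P X (X w) (V w)).
Proof.
rewrite (_ : (fun w => _) = fun w =>
  if 0 <= X w then (- quant X' (rlevel w))%E else quant X (rlevel w)).
  apply: measurable_fun_ifT.
  - exact: measurable_fun_ler.
  - apply: measurableT_comp => //; exact: measurable_quant_rlevel.
  - exact: measurable_quant_rlevel.
by apply/funext => w; rewrite recipE.
Qed.

End level_law.

(** * Factoring y as a product of two nondecreasing functions *)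

Section factor_pair.
Context (R : realType).
Implicit Types (A : set R) (f g : R -> R).

(** The shape of [d] and [- c] as functions of [y]. Monotonicity of both factors
    already forces continuity of each away from 0. *)
Definition factor_pair A f g := [/\ forall y, A y -> 0 <= f y /\ 0 <= g y,
  forall y, A y -> g y * f y = y &
  forall y z, A y -> A z -> y <= z -> g y <= g z /\ f y <= f z].

Lemma factor_pair_sym A f g : factor_pair A f g -> factor_pair A g f.
Proof.
move=> [H0 HM Hle]; split.
- by move=> y /H0[].
- by move=> y /HM; rewrite mulrC.
- by move=> y z Ay Az /(Hle _ _ Ay Az)[].
Qed.

Lemma factor_pair_gt0 A f g y : factor_pair A f g -> A y -> y != 0 ->
  0 < f y /\ 0 < g y.
Proof.
move=> [H0 HM _] Ay yn0; have [f0 g0] := H0 _ Ay.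
by rewrite !lt_neqAle f0 g0 !andbT; split; apply: contra_neqN yn0 => /eqP;
  rewrite -{2}(HM _ Ay) => <-; rewrite ?mulr0 ?mul0r.
Qed.

(** For [y <= z] we have [f z * g y <= f z * g z = z], which subtracted from
    [f y * g y = y] bounds the increase of [f] by that of the product; the case
    [z <= y] is symmetric. *)
Lemma factor_pair_lipschitz A f g y z : factor_pair A f g -> A y -> y != 0 ->
  A z -> `|f z - f y| <= `|z - y| / g y.
Proof.
move=> fg Ay yn0 Az; have [_ gy0] := factor_pair_gt0 fg Ay yn0.
case: (fg) => H0 HM Hle; rewrite ler_pdivlMr//.
have [fz0 _] := H0 _ Az.
have [yz|/ltW zy] := leP y z.
  have [gyz fyz] := Hle _ _ Ay Az yz.
  rewrite !ger0_norm ?subr_ge0// mulrBl [f y * _]mulrC HM// lerD2r.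
  by rewrite -{2}(HM _ Az) mulrC ler_wpM2r.
have [gzy fzy] := Hle _ _ Az Ay zy.
rewrite !ler0_norm ?subr_le0// !opprB mulrBl [f y * _]mulrC HM// lerD2l lerN2.
by rewrite -{1}(HM _ Az) mulrC ler_wpM2l.
Qed.

Lemma within_continuous_dist A f :
  (forall y, A y -> forall e, 0 < e -> exists2 r, 0 < r &
     forall z, A z -> `|z - y| < r -> `|f z - f y| <= e) ->
  {within A, continuous f}.
Proof.
move=> H; apply/subspace_continuousP => y Ay; apply/cvgrPdist_le => e e0.
have [r r0 Hr] := H y Ay e e0; rewrite near_withinE.
apply/nbhs_ballP; exists r => // z; rewrite -ball_normE /= distrC => zy Az.
by rewrite distrC; exact: Hr.
Qed.

Lemma factor_pair_dist A f g y e : factor_pair A f g -> A y -> y != 0 -> 0 < e ->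
  exists2 r, 0 < r & forall z, A z -> `|z - y| < r -> `|f z - f y| <= e.
Proof.
move=> fg Ay yn0 e0; have [_ gy0] := factor_pair_gt0 fg Ay yn0.
exists (e * g y); first exact: mulr_gt0.
move=> z Az zy; apply: le_trans (factor_pair_lipschitz fg Ay yn0 Az) _.
by rewrite ler_pdivrMr// ltW.
Qed.

Lemma factor_pair_continuousD0 A f g : factor_pair A f g ->
  {within A `\ 0, continuous f}.
Proof.
move=> fg; apply: within_continuous_dist => y [Ay /eqP yn0] e e0.
have [r r0 Hr] := factor_pair_dist fg Ay yn0 e0.
by exists r => // z [Az _]; exact: Hr.
Qed.

(** Lipschitz bounds settle all points except 0, where [g y] may vanish. *)
Lemma factor_pair_continuous A f g : factor_pair A f g ->
  (A 0 -> forall e, 0 < e ->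
     exists2 r, 0 < r & forall z, A z -> z < r -> `|f z - f 0| <= e) ->
  {within A, continuous f}.
Proof.
move=> fg H; apply: within_continuous_dist => y Ay e e0.
have [y0|yn0] := eqVneq y 0; last exact: factor_pair_dist fg Ay yn0 e0.
rewrite {}y0 in Ay *; have [r r0 Hr] := H Ay e e0.
by exists r => // z Az; rewrite subr0 => /ltr_normlW; exact: Hr.
Qed.

End factor_pair.

(** * Existence of the disintegrating pair *)

Section disintegration.
Context d (T : measurableType d) (R : realType) (P : probability T R).
Variables (X : {RV P >-> R}) (hX : zero_mean P X).
Variables (U : {RV P >-> R}) (hU : uniform01 U) (hXU : independent_RV P X U).
Local Notation X' := (\- X : {RV P >-> R}).
Local Notation V := (Urand P X U).
Local Notation m := (total X).

Let iX : P.-integrable [set: T] (EFin \o X) := hX.1.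
Let iX' : P.-integrable [set: T] (EFin \o X') := integrable_opp iX.
Let hV : randomizer X V := Urand_randomizer hU hXU.

(** [|X r(X, U_X)|] as a function of the level. *)
Definition qprod (h : R) : R := qplus X h * qminus X h.

Lemma qprod_gt0 h : 0 < h < m -> 0 < qprod h.
Proof. by move=> hm; apply: mulr_gt0; [exact: qplus_gt0|exact: qminus_gt0]. Qed.

Lemma le_qprod h k : 0 < h -> h <= k -> k < m -> qprod h <= qprod k.
Proof.
move=> h0 hk km; have hm : 0 < h < m by rewrite h0 (le_lt_trans hk).
have [ph mh] := (qplus_gt0 hX hm, qminus_gt0 hX hm).
by apply: ler_pM; [exact: ltW|exact: ltW|exact: le_qplus|exact: le_qminus].
Qed.

(** If [h > k], both factors can only decrease from [h] to [k]; as they are positive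
    and their product does not decrease, neither factor does. Hence the
    product determines its factors. *)
Lemma le_quantiles_of_qprod h k : 0 < h < m -> 0 < k < m -> qprod h <= qprod k ->
  qplus X h <= qplus X k /\ qminus X h <= qminus X k.
Proof.
move=> h0m k0m Qhk; have [h0 hm] := andP h0m; have [k0 km] := andP k0m.
have [hk|/ltW kh] := leP h k.
  by rewrite le_qplus ?le_qminus.
have pk := qplus_gt0 hX k0m; have mk := qminus_gt0 hX k0m.
have ph := qplus_gt0 hX h0m; have mh := qminus_gt0 hX h0m.
have pkh := le_qplus hX kh hm; have mkh := le_qminus hX kh hm.
split.
  rewrite -(ler_pM2r mh); apply: le_trans Qhk _.
  by rewrite ler_wpM2l// ltW.
rewrite -(ler_pM2l ph); apply: le_trans Qhk _.
by rewrite ler_wpM2r// ltW.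
Qed.

Lemma good_cases w : good_event X V w ->
  (X w = 0 /\ recipX P X U w = 0%E) \/
  (0 < rlevel X V w < m /\
   ((X w = qplus X (rlevel X V w) /\
     recipX P X U w = (- qminus X (rlevel X V w))%:E) \/
    (X w = - qminus X (rlevel X V w) /\
     recipX P X U w = (qplus X (rlevel X V w))%:E))).
Proof.
move=> gw; have [X0|X0|X0] := ltgtP (X w) 0.
- by right; have [? ? ?] := recip_lt0 hX gw X0; split => //; right.
- by right; have [? ? ?] := recip_gt0 hX gw X0; split => //; left.
- by left; split => //; exact: recip_eq0.
Qed.

Lemma absprod_eq0 w : X w = 0 -> absprod P X U w = 0%E.
Proof. by move=> X0; rewrite /absprod X0 mul0e abse0. Qed.

Lemma absprod_neq0 w : good_event X V w -> X w != 0 ->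
  absprod P X U w = (qprod (rlevel X V w))%:E.
Proof.
move=> gw /negP Xn0; rewrite /absprod /qprod.
have [[X0 _]|[hm [][-> ->]]] := good_cases gw.
- by case: Xn0; rewrite X0.
- rewrite -EFinM /= mulrN normrN ger0_norm// ltW//; exact: qprod_gt0.
- rewrite -EFinM /= mulNr normrN ger0_norm mulrC// ltW//; exact: qprod_gt0.
Qed.

Definition qinv (y : R) : R := get [set h | 0 < h < m /\ qprod h = y].

(** [dtilde] and [nctilde] are the functions written [d] and [- c] in the statement:
    the two quantiles at a level whose product is [y]. *)
Definition dtilde (y : R) : R := if y == 0 then 0 else qplus X (qinv y).
Definition nctilde (y : R) : R := if y == 0 then 0 else qminus X (qinv y).

Lemma dtilde_nctilde_qprod h : 0 < h < m ->
  dtilde (qprod h) = qplus X h /\ nctilde (qprod h) = qminus X h.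
Proof.
move=> hm; have Qn0 : (qprod h == 0) = false by rewrite gt_eqF// qprod_gt0.
rewrite /dtilde /nctilde Qn0.
have [h'm Qh'] : [set k | 0 < k < m /\ qprod k = qprod h] (qinv (qprod h)).
  by apply: getPex; exists h.
have QQ' : qprod (qinv (qprod h)) <= qprod h by rewrite Qh'.
have Q'Q : qprod h <= qprod (qinv (qprod h)) by rewrite Qh'.
have [p1 m1] := le_quantiles_of_qprod h'm hm QQ'.
have [p2 m2] := le_quantiles_of_qprod hm h'm Q'Q.
by split; apply: le_anti; rewrite ?p1 ?p2 ?m1 ?m2.
Qed.

(** A null set of zeros of [X] would make 0 a point of [valuesY] at which continuity
    may fail, so the second condition discards it. *)
Definition base_event : set T := [set w | good_event X V w] `&`
  [set w | X w = 0 -> P (X @^-1` [set 0]) != 0%E].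

Lemma measurable_base_event : measurable base_event.
Proof.
apply: measurableI; first exact: measurable_good_event.
have [P0|P0] := eqVneq (P (X @^-1` [set 0])) 0%E.
  rewrite (_ : mkset _ = ~` (X @^-1` [set 0])).
    by apply: measurableC; exact: measurable_funPTI.
  apply/seteqP; split => w; last by move=> nX /nX.
  by move=> H X0; have := H X0.
by rewrite [X in measurable X](_ : _ = setT)//; apply/seteqP; split.
Qed.

Lemma base_event_ae : {ae P, forall w, base_event w}.
Proof.
have H : {ae P, forall w, X w = 0 -> P (X @^-1` [set 0]) != 0%E}.
  have [P0|P0] := eqVneq (P (X @^-1` [set 0])) 0%E; last exact: nearW.
  have mX0 : measurable (X @^-1` [set 0]) by exact: measurable_funPTI.
  exists (X @^-1` [set 0]); split => //.
  by move=> w /= /not_implyP[].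
by apply: filterS2 (good_event_ae hX hV) H.
Qed.

Lemma valuesY_base y : valuesY P X U base_event y ->
  (y = 0 /\ P (X @^-1` [set 0]) != 0%E) \/ exists2 h, 0 < h < m & y = qprod h.
Proof.
move=> [w [gw H0]]; have [X0|Xn0] := eqVneq (X w) 0.
  by rewrite absprod_eq0// => -[<-]; left; split => //; exact: H0.
have [[X0 _]|[hm _]] := good_cases gw; first by rewrite X0 eqxx in Xn0.
by rewrite absprod_neq0// => -[<-]; right; exists (rlevel X V w).
Qed.

Lemma dtilde_nctilde_factor : factor_pair (valuesY P X U base_event) dtilde nctilde.
Proof.
have df0 : dtilde 0 = 0 by rewrite /dtilde eqxx.
have ef0 : nctilde 0 = 0 by rewrite /nctilde eqxx.
split.
- move=> y /valuesY_base[[-> _]|[h hm ->]]; first by rewrite df0 ef0.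
  have [-> ->] := dtilde_nctilde_qprod hm.
  by split; apply: ltW; [exact: qplus_gt0|exact: qminus_gt0].
- move=> y /valuesY_base[[-> _]|[h hm ->]]; first by rewrite df0 mulr0.
  by have [-> ->] := dtilde_nctilde_qprod hm; rewrite mulrC.
- move=> y z /valuesY_base[[-> _]|[h hm ->]] /valuesY_base[[-> _]|[k km ->]].
  + by [].
  + rewrite df0 ef0; have [-> ->] := dtilde_nctilde_qprod km.
    by move=> _; split; apply: ltW; [exact: qminus_gt0|exact: qplus_gt0].
  + by rewrite leNgt qprod_gt0.
  + have [-> ->] := dtilde_nctilde_qprod hm; have [-> ->] := dtilde_nctilde_qprod km.
    by move=> /(le_quantiles_of_qprod hm km)[].
Qed.

Lemma cumle_gt0 (Z : {RV P >-> R}) (iZ : P.-integrable [set: T] (EFin \o Z)) e :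
  (0 < P (Z @^-1` `]0%R, e[))%E -> 0 < cumle Z e.
Proof.
move=> Pe; rewrite lt_neqAle cumle_ge0 andbT; apply/negP => /eqP c0.
have : {ae P, forall w, 0 < Z w -> ~ [set w | Z w <= e] w}.
  apply: posmass_eq0; first exact: measurable_RVle.
  by rewrite -cumleE// -c0.
move=> [N [mN N0 subN]]; suff : P (Z @^-1` `]0%R, e[) = 0%E.
  by move=> P0; rewrite P0 ltxx in Pe.
apply: subset_measure0 N0 => //; first exact: measurable_funPTI.
move=> w /=; rewrite in_itv/= => /andP[Z0 Ze]; apply: subN => /= H.
by apply: (H Z0); exact: ltW.
Qed.

Lemma quant_ge (Z : {RV P >-> R}) (iZ : P.-integrable [set: T] (EFin \o Z)) e h :
  ~ (0 < P (Z @^-1` `]0%R, e[))%E -> 0 < h -> (e%:E <= quant Z h)%E.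
Proof.
move=> /negP; rewrite -leNgt measure_le0 => /eqP Pe h0.
rewrite leNgt; apply/negP => qe.
have qfin : quant Z h \is a fin_num.
  by rewrite ge0_fin_numE ?quant_ge0// (lt_trans qe)// ltry.
have te : fine (quant Z h) < e by rewrite -lte_fin fineK.
have : h <= cumle Z (fine (quant Z h)).
  by rewrite -quant_le ?fineK// fine_ge0// quant_ge0.
suff -> : cumle Z (fine (quant Z h)) = 0 by rewrite leNgt h0.
apply/EFin_inj; rewrite cumleE//; transitivity (posmass Z set0); last exact: measure0.
apply: posmass_ae => //; first exact: measurable_RVle.
exists (Z @^-1` `]0%R, e[); split => //; first exact: measurable_funPTI.
move=> w /= nH; rewrite in_itv/=; apply: contrapT => H; apply: nH => Z0.
by split => // Zt; apply: H; rewrite Z0/= (le_lt_trans Zt).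
Qed.

Lemma preimage_opp_itv e : X @^-1` `](- e)%R, 0%R[ = X' @^-1` `]0%R, e[.
Proof.
by apply/seteqP; split => w; rewrite /= !in_itv/= oppr_gt0 ltrNl andbC.
Qed.

(** Here [P (X = 0) > 0], so the law of [X] accumulates at 0 on both sides or on
    neither. If on both, both quantiles are small at small levels, and small [y]
    come from small levels. If on neither, both quantiles stay away from 0, so 0 is
    an isolated point of [valuesY]. *)
Lemma dtilde_nctilde_cvg0 : ~ one_sided_at0 P X ->
  valuesY P X U base_event 0 -> forall e, 0 < e ->
  exists2 r, 0 < r & forall z, valuesY P X U base_event z -> z < r ->
    dtilde z <= e /\ nctilde z <= e.
Proof.
move=> nos V0 e e0.
have P0 : (0 < P (X @^-1` [set 0%R]))%E.
  rewrite lt0e measure_ge0 andbT.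
  case: (valuesY_base V0) => [[]//|[h hm Qh]].
  by have := qprod_gt0 hm; rewrite -Qh ltxx.
have {}nos : (forall e : R, 0 < e -> (0 < P (X @^-1` `]0%R, e[))%E) <->
     (forall e : R, 0 < e -> (0 < P (X @^-1` `](- e)%R, 0%R[))%E).
  by apply: contrapT => H; apply: nos.
have [both|nboth] := pselect (forall e : R, 0 < e -> (0 < P (X @^-1` `]0%R, e[))%E).
  have both' := nos.1 both.
  have cp := cumle_gt0 iX (both _ e0).
  have cm : 0 < cumle X' e.
    by apply: cumle_gt0 => //; rewrite -preimage_opp_itv; exact: both'.
  have m0 : 0 < m by exact: lt_le_trans cp (cumle_le_total iX _).
  (* Half of the total keeps the level inside the open interval where quantiles are
     finite; the two masses at [e] keep both quantiles below [e]. *)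
  pose k := Num.min (m / 2) (Num.min (cumle X e) (cumle X' e)).
  have km : 0 < k < m.
    rewrite /k !lt_min cp cm divr_gt0//= gt_min.
    by rewrite ltr_pdivrMr// ltr_pMr// ltr1n.
  have [_ kltm] := andP km.
  (* A value below [qprod k] can only come from a level at most [k]. *)
  exists (qprod k); first exact: qprod_gt0.
  move=> z /valuesY_base[[-> _] _|[h hm ->]].
    by rewrite /dtilde /nctilde eqxx ltW.
  have [-> ->] := dtilde_nctilde_qprod hm.
  rewrite ltNge => /negP Qkh; have hk : h <= k.
    rewrite leNgt; apply/negP => kh; apply: Qkh.
    by apply: le_qprod; case/andP: hm; case/andP: km => // *; exact: ltW.
  split; first apply: le_trans (le_qplus hX hk kltm) _.
    by rewrite -lee_fin -(qplusE hX kltm) (quant_le iX) ?(ltW e0)// /k !ge_min lexx !orbT.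
  apply: le_trans (le_qminus hX hk kltm) _.
  rewrite -lee_fin -(qminusE hX kltm) (quant_le iX') ?(ltW e0)//.
  by rewrite /k !ge_min lexx !orbT.
have nboth' : ~ (forall e : R, 0 < e -> (0 < P (X @^-1` `](- e)%R, 0%R[))%E).
  by move=> /nos.2.
(* No mass within [e1] on the right and [e2] on the left of 0 makes every nonzero
   product at least [e1 * e2]. *)
have /existsNP[e1 /not_implyP[e10 H1]] := nboth.
have /existsNP[e2 /not_implyP[e20 H2]] := nboth'.
exists (e1 * e2); first exact: mulr_gt0.
move=> z /valuesY_base[[-> _] _|[h hm ->]].
  by rewrite /dtilde /nctilde eqxx ltW.
have [h0 hltm] := andP hm.
rewrite ltNge => /negP[].
apply: ler_pM; [exact: ltW|exact: ltW| |]; rewrite -lee_fin.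
  by rewrite -(qplusE hX hltm); exact: quant_ge.
rewrite -(qminusE hX hltm); apply: quant_ge => //.
by rewrite -preimage_opp_itv.
Qed.

Lemma disintegrating_pair_base :
  disintegrating_pair P X U base_event (fun y => - nctilde y) dtilde.
Proof.
have fp := dtilde_nctilde_factor; have fp' := factor_pair_sym fp.
have d0 : dtilde 0 = 0 by rewrite /dtilde eqxx.
have e0 : nctilde 0 = 0 by rewrite /nctilde eqxx.
split.
- split; first exact: measurable_base_event.
  by apply: probability_ae1; [exact: measurable_base_event|exact: base_event_ae].
- by case: fp => H0 _ _ y /H0[? ?]; rewrite oppr_le0.
- split; last exact: factor_pair_continuousD0 fp.
  by move=> y; apply: continuousN; exact: (factor_pair_continuousD0 fp').
- move=> nos; split; last first.
    apply: (factor_pair_continuous fp) => V0 e ep.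
    have [r r0 Hr] := dtilde_nctilde_cvg0 nos V0 ep.
    exists r => // z Az zr; have [dz _] := Hr z Az zr.
    case: (fp) => /(_ z Az)[dz0 _] _ _.
    by rewrite d0 subr0 ger0_norm.
  move=> y; apply: continuousN; apply: (factor_pair_continuous fp') => V0 e ep.
  have [r r0 Hr] := dtilde_nctilde_cvg0 nos V0 ep.
  exists r => // z Az zr; have [_ ez] := Hr z Az zr.
  case: (fp) => /(_ z Az)[_ ez0] _ _.
  by rewrite e0 subr0 ger0_norm.
- by case: fp => _ _ Hle y z Ay Az /(Hle _ _ Ay Az); rewrite !opprK.
- move=> w [gw _]; have [[X0 r0]|[hm XR]] := good_cases gw.
    by rewrite r0 absprod_eq0//= e0 d0 oppr0 X0.
  have Xn0 : X w != 0.
    have [ph mh] := (qplus_gt0 hX hm, qminus_gt0 hX hm).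
    by case: XR => -[-> _]; rewrite ?oppr_eq0 gt_eqF.
  rewrite absprod_neq0//=; have [-> ->] := dtilde_nctilde_qprod hm.
  by case: XR => -[-> ->]; rewrite // setUC.
- move=> w [gw _]; have [[X0 r0]|[hm XR]] := good_cases gw.
    by rewrite absprod_eq0//= e0 d0 mulr0.
  have Xn0 : X w != 0.
    have [ph mh] := (qplus_gt0 hX hm, qminus_gt0 hX hm).
    by case: XR => -[-> _]; rewrite ?oppr_eq0 gt_eqF.
  rewrite absprod_neq0//=; have [-> ->] := dtilde_nctilde_qprod hm.
  by rewrite opprK mulrC.
Qed.

Lemma measurable_absprod : measurable_fun [set: T] (absprod P X U).
Proof.
apply: measurableT_comp => //; apply: emeasurable_funM.
  exact/measurable_EFinP.
exact: measurable_recip hX _ hV.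
Qed.

End disintegration.

(** * Variables with two values *)

Section two_points.
Context d (T : measurableType d) (R : realType) (P : probability T R).
Variables (D : {RV P >-> R}) (c e p q : R).
Hypotheses (ce : c != e) (pq : p + q = 1).
Hypotheses (Pe : P (D @^-1` [set e]) = p%:E) (Pc : P (D @^-1` [set c]) = q%:E).

Let mD x : measurable (D @^-1` [set x]).
Proof. exact: measurable_funPTI. Qed.

Lemma two_points_ae : {ae P, forall w, D w = c \/ D w = e}.
Proof.
have mU : measurable (D @^-1` [set c] `|` D @^-1` [set e]) by exact: measurableU.
have PU : P (D @^-1` [set c] `|` D @^-1` [set e]) = 1%E.
  transitivity (P (D @^-1` [set c]) + P (D @^-1` [set e]))%E.
    apply: measureU => //.
    by apply/seteqP; split => w //= [-> ce']; move: ce; rewrite ce' eqxx.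
  by rewrite Pc Pe -EFinD addrC pq.
exists (~` (D @^-1` [set c] `|` D @^-1` [set e])); split => //.
- exact: measurableC.
- by rewrite probability_setC// [X in (1 - X)%E]PU subee.
Qed.

Lemma expectation_two_points (G : R -> R) : measurable_fun [set: R] G ->
  ('E_P[fun w => G (D w)] = (G e * p + G c * q)%:E)%E.
Proof.
move=> mG; rewrite unlock.
transitivity (\int[P]_w ((G e)%:E * (\1_(D @^-1` [set e]) w)%:E +
                         (G c)%:E * (\1_(D @^-1` [set c]) w)%:E))%E.
  have mi x : measurable_fun [set: T] (fun w => (G x)%:E * (\1_(D @^-1` [set x]) w)%:E)%E.
    by apply: emeasurable_funM => //; apply/measurable_EFinP; exact: measurable_indic.
  apply: ae_eq_integral => //.
  - by apply/measurable_EFinP; exact: measurableT_comp mG _.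
  - exact: emeasurable_funD.
  have indE x w : \1_(D @^-1` [set x]) w = (D w == x)%:R :> R.
    by rewrite indicE; congr ((nat_of_bool _)%:R); apply/idP/eqP; rewrite inE.
  apply: filterS two_points_ae => w Dw _; rewrite !indE.
  case: Dw => ->; rewrite eqxx.
    by rewrite (negbTE ce) mule0 add0e mule1.
  by rewrite eq_sym (negbTE ce) mule0 adde0 mule1.
have ii x : P.-integrable [set: T] (EFin \o \1_(D @^-1` [set x])).
  by apply: integrable_indic => //; rewrite setTI -ge0_fin_numE// fin_num_measure.
rewrite integralD//; [|apply: integrableZl => //; exact: ii|apply: integrableZl => //; exact: ii].
rewrite (integralZl measurableT (ii e)) (integralZl measurableT (ii c)).
by rewrite !integral_indic// !setIT [X in (_ * X + _)%E]Pe [X in (_ + _ * X)%E]Pc.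
Qed.

End two_points.

(** * The conditional law of X given Y *)

Section conditional_law.
Context d (T : measurableType d) (R : realType) (P : probability T R).
Variables (X : {RV P >-> R}) (hX : zero_mean P X).
Variables (U : {RV P >-> R}) (hU : uniform01 U) (hXU : independent_RV P X U).
Local Notation X' := (\- X : {RV P >-> R}).
Local Notation V := (Urand P X U).
Local Notation m := (total X).
Local Notation S := (rlevel X V).

Let iX : P.-integrable [set: T] (EFin \o X) := hX.1.
Let iX' : P.-integrable [set: T] (EFin \o X') := integrable_opp iX.
Let hV : randomizer X V := Urand_randomizer hU hXU.
Let mS : measurable_fun [set: T] S := measurable_rlevel hX hV.

(** The negative side is carried over to the positive one by [rlevel_law]. *)
Lemma integral_levels (u v : R -> R) (k : R) :
  measurable_fun [set: R] u -> measurable_fun [set: R] v ->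
  (forall h, 0 <= u h) -> (forall h, 0 <= v h) -> 0 <= k ->
  (\int[P]_w (u (S w) * X^\+ w + v (S w) * X'^\+ w +
     k * \1_(X @^-1` [set 0]) w)%:E =
   \int[P]_w ((u (S w) + v (S w)) * X^\+ w)%:E + k%:E * P (X @^-1` [set 0%R]))%E.
Proof.
move=> mu mv u0 v0 k0.
have mX0 : measurable (X @^-1` [set 0]) by exact: measurable_funPTI.
have mp (Y : {RV P >-> R}) (f : R -> R) : measurable_fun [set: R] f ->
    measurable_fun [set: T] (fun w => (f (S w) * Y^\+ w)%:E).
  move=> mf; apply/measurable_EFinP; apply: measurable_funM => //.
  exact: measurableT_comp mf mS.
have p0 (Y : {RV P >-> R}) (f : R -> R) : (forall h, 0 <= f h) ->
    forall w, (0 <= (f (S w) * Y^\+ w)%:E)%E.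
  by move=> f0 w; rewrite lee_fin mulr_ge0// funrpos_ge0.
have mk : measurable_fun [set: T] (fun w => (k * \1_(X @^-1` [set 0]) w)%:E).
  by apply/measurable_EFinP; apply: measurable_funM => //; exact: measurable_indic.
under eq_integral do rewrite EFinD EFinD.
rewrite ge0_integralD//; last 3 first.
- by move=> w _; rewrite adde_ge0// p0.
- by apply: emeasurable_funD; exact: mp.
- by move=> w _; rewrite lee_fin mulr_ge0.
congr (_ + _)%E; last first.
  under eq_integral do rewrite EFinM.
  rewrite ge0_integralZl//.
  + by rewrite integral_indic// setIT.
  + by apply/measurable_EFinP; exact: measurable_indic.
under [RHS]eq_integral do rewrite mulrDl EFinD.
rewrite !ge0_integralD//; last 8 first.
- by move=> w _; exact: p0.
- exact: mp.
- by move=> w _; exact: p0.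
- exact: mp.
- by move=> w _; exact: p0.
- exact: mp.
- by move=> w _; exact: p0.
- exact: mp.
congr (_ + _)%E.
under eq_integral do rewrite EFinM; under [RHS]eq_integral do rewrite EFinM.
rewrite -(rlevel_law hX hV (f := EFin \o v))//.
exact/measurable_EFinP.
Qed.

Variables (O : set T) (c e : R -> R) (dp : disintegrating_pair P X U O c e).
Local Notation V0 := (valuesY P X U O).

Lemma pair_product y : V0 y -> - c y * e y = y.
Proof.
by move=> [w Ow Yw]; have := dp_prod dp Ow; rewrite Yw => -[].
Qed.

Lemma pair_sign y : V0 y -> y != 0 -> c y < 0 < e y.
Proof.
move=> Vy yn0; have [c0 e0] := dp_sign dp Vy.
rewrite !lt_neqAle c0 e0 !andbT; apply/andP.
split; apply: contra_neqN yn0 => /eqP H; rewrite -(pair_product Vy).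
  by rewrite H oppr0 mul0r.
by rewrite -H mulr0.
Qed.

Lemma valuesY_good w : O w -> good_event X V w -> X w != 0 ->
  V0 (qprod X (S w)).
Proof. by move=> Ow gw Xn0; exists w => //; exact: absprod_neq0. Qed.

(** Signs decide which element of the pair is which, so any disintegrating pair
    agrees with the quantiles at the level. *)
Lemma pair_good w : O w -> good_event X V w -> X w != 0 ->
  c (qprod X (S w)) = - qminus X (S w) /\ e (qprod X (S w)) = qplus X (S w).
Proof.
move=> Ow gw Xn0; have [c0 e0] := dp_sign dp (valuesY_good Ow gw Xn0).
have := dp_pair dp Ow; rewrite (absprod_neq0 hX)//=.
have [[X0 _]|[hm XR]] := good_cases hX gw; first by rewrite X0 eqxx in Xn0.
have [ph mh] := (qplus_gt0 hX hm, qminus_gt0 hX hm).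
set p := qplus X (S w) in ph XR *; set q := qminus X (S w) in mh XR *.
have -> : [set (X w)%:E; recipX P X U w] = [set p%:E; (- q)%:E].
  by case: XR => -[-> ->]//; rewrite setUC.
set c' := c _ in c0 *; set e' := e _ in e0 *.
move=> /seteqP[sub1 sub2]; split.
  have [[]|[]//] : [set c'%:E; e'%:E] (- q)%:E by apply: sub1; right.
    by move=> ->.
  by move=> e'q; move: e0; rewrite -e'q oppr_ge0 leNgt mh.
have [[]|[]//] : [set c'%:E; e'%:E] p%:E by apply: sub1; left.
by move=> pc; move: c0; rewrite -pc leNgt ph.
Qed.

Lemma pair_zero w : O w -> X w = 0 -> V0 0.
Proof. by move=> Ow X0; exists w => //; exact: absprod_eq0. Qed.

Section disintegration_formula.
Variables (F : R * R -> R) (mF : measurable_fun [set: R * R] F)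
  (F0 : forall z, 0 <= F z).

(** [E F(D_y, y)] for the two-valued variable [D_y]. *)
Definition two_point_mean (y : R) : R :=
  if y == 0 then F (0, 0) else
  F (e y, y) * (`|c y| / (`|c y| + e y)) + F (c y, y) * (e y / (`|c y| + e y)).

Variables (phi : R -> \bar R) (mphi : measurable_fun [set: R] phi).
Hypotheses (phi0 : forall y, (0 <= phi y)%E)
  (phiE : forall y, V0 y -> phi y = (two_point_mean y)%:E).

Local Notation Y := (fun w => fine (absprod P X U w)).

Let Fplus h := F (qplus X h, qprod X h).
Let Fminus h := F (- qminus X h, qprod X h).
Let Fmean h := (qminus X h * Fplus h + qplus X h * Fminus h) /
  (qminus X h + qplus X h).

Let qp0 h : 0 <= qplus X h. Proof. by rewrite fine_ge0// quant_ge0. Qed.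
Let qm0 h : 0 <= qminus X h. Proof. by rewrite fine_ge0// quant_ge0. Qed.

Let mqprod : measurable_fun [set: R] (qprod X).
Proof.
by apply: measurable_funM; [exact: measurable_qplus|exact: measurable_qminus].
Qed.

Let mFplus : measurable_fun [set: R] Fplus.
Proof.
apply: measurableT_comp mF _; apply: measurable_fun_pair => //.
exact: measurable_qplus.
Qed.

Let mFminus : measurable_fun [set: R] Fminus.
Proof.
apply: measurableT_comp mF _; apply: measurable_fun_pair => //.
by apply: measurableT_comp => //; exact: measurable_qminus.
Qed.

Let mFmean : measurable_fun [set: R] Fmean.
Proof.
have mp : measurable_fun [set: R] (qplus X) by exact: measurable_qplus.
have mm : measurable_fun [set: R] (qminus X) by exact: measurable_qminus.
apply: measurable_fun_div.
- by apply: measurable_funD; exact: measurable_funM.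
- exact: measurable_funD.
- by move=> h; rewrite addr_ge0.
Qed.

Let Fmean0 h : 0 <= Fmean h.
Proof. by rewrite divr_ge0// addr_ge0// mulr_ge0//; exact: F0. Qed.

Lemma measurable_Y : measurable_fun [set: T] Y.
Proof. by apply: measurableT_comp => //; exact: measurable_absprod. Qed.

Lemma funrpos_opp_sign w :
  [\/ [/\ X w = 0, X^\+ w = 0 & X'^\+ w = 0],
      [/\ 0 < X w, X^\+ w = X w & X'^\+ w = 0] |
      [/\ X w < 0, X^\+ w = 0 & X'^\+ w = - X w] ].
Proof.
rewrite /funrpos /=; have [X0|X0|->] := ltgtP (X w) 0.
- by apply: Or33; split => //; rewrite max_l// oppr_ge0 ltW.
- by apply: Or32; split => //; rewrite max_r// oppr_le0 ltW.
- by apply: Or31; rewrite oppr0 maxxx.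
Qed.

Let ae_good : {ae P, forall w, O w /\ good_event X V w}.
Proof.
have [mO PO] := dp_event dp.
have aeO : {ae P, forall w, O w}.
  exists (~` O); split => //; first exact: measurableC.
  by rewrite probability_setC// PO subee.
exact: filterS2 aeO (good_event_ae hX hV).
Qed.

(** Let [b] and [a] be the quantiles of [X] and [\- X] at the level. Where [X > 0] we
    have [X^+ / b = 1], and where [X < 0] we have [X^- / a = 1]. Both sides are
    therefore of the form treated by [integral_levels], and it remains to compare
    the sums of the coefficients of [X^+]: with [B] and [A] the values of [F] at
    [(b, a b)] and [(- a, a b)],
    [B / b + A / a = M / b + M / a] for [M = (a B + b A) / (a + b)]. *)
Lemma expectation_disintegration :
  ('E_P[fun w => F (X w, Y w)] = \int[P]_w phi (Y w))%E.
Proof.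
rewrite unlock.
have mY := measurable_Y.
have mX0 : measurable (X @^-1` [set 0]) by exact: measurable_funPTI.
pose k := F (0, 0).
pose I (u v : R -> R) w := u (S w) * X^\+ w + v (S w) * X'^\+ w + k * \1_(X @^-1` [set 0]) w.
have mI (u v : R -> R) : measurable_fun [set: R] u -> measurable_fun [set: R] v ->
    measurable_fun [set: T] (fun w => (I u v w)%:E).
  move=> mu mv; apply/measurable_EFinP; apply: measurable_funD.
    apply: measurable_funD; apply: measurable_funM => //.
      exact: measurableT_comp mu mS.
    exact: measurableT_comp mv mS.
  by apply: measurable_funM => //; exact: measurable_indic.
have I0 (u v : R -> R) w : (forall h, 0 <= u h) -> (forall h, 0 <= v h) -> (0 <= (I u v w)%:E)%E.
  move=> u0 v0; rewrite lee_fin /I.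
  by rewrite !addr_ge0// mulr_ge0// ?funrpos_ge0//; exact: F0.
have mdivp (f : R -> R) : measurable_fun [set: R] f ->
    measurable_fun [set: R] (fun h => f h / qplus X h).
  by move=> mf; apply: measurable_fun_div => //; exact: measurable_qplus.
have mdivm (f : R -> R) : measurable_fun [set: R] f ->
    measurable_fun [set: R] (fun h => f h / qminus X h).
  by move=> mf; apply: measurable_fun_div => //; exact: measurable_qminus.
have divp0 (f : R -> R) : (forall h, 0 <= f h) -> forall h, 0 <= f h / qplus X h.
  by move=> f0 h; rewrite divr_ge0.
have divm0 (f : R -> R) : (forall h, 0 <= f h) -> forall h, 0 <= f h / qminus X h.
  by move=> f0 h; rewrite divr_ge0.
have Fp0 h : 0 <= Fplus h by exact: F0.
have Fm0 h : 0 <= Fminus h by exact: F0.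
have indE w : \1_(X @^-1` [set 0]) w = (X w == 0)%:R :> R.
  by rewrite indicE; congr ((nat_of_bool _)%:R); apply/idP/eqP; rewrite inE.
transitivity (\int[P]_w (I (fun h => Fplus h / qplus X h)
    (fun h => Fminus h / qminus X h) w)%:E)%E.
  apply: ge0_ae_eq_integral => //.
  - apply/measurable_EFinP; apply: measurableT_comp mF _.
    exact: measurable_fun_pair.
  - by apply: mI; [exact: mdivp|exact: mdivm].
  - by move=> w _; rewrite lee_fin.
  - by move=> w _; apply: I0; [exact: divp0|exact: divm0].
  apply: filterS ae_good => w [Ow gw] _; rewrite /I indE.
  have [[X0 -> ->]|[X0 -> ->]|[X0 -> ->]] := funrpos_opp_sign w.
  - by rewrite absprod_eq0//= X0 eqxx !mulr0 !add0r mulr1.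
  - have [hm Xw _] := recip_gt0 hX gw X0.
    rewrite (absprod_neq0 hX gw) ?gt_eqF//= !mulr0 !addr0 Xw divfK//.
    by rewrite gt_eqF// qplus_gt0.
  - have [hm Xw _] := recip_lt0 hX gw X0.
    rewrite (absprod_neq0 hX gw) ?lt_eqF//= !mulr0 !(addr0, add0r) Xw opprK divfK//.
    by rewrite gt_eqF// qminus_gt0.
transitivity (\int[P]_w (I (fun h => Fmean h / qplus X h)
    (fun h => Fmean h / qminus X h) w)%:E)%E; last first.
  apply: ge0_ae_eq_integral => //.
  - by apply: mI; [exact: mdivp|exact: mdivm].
  - exact: measurableT_comp mphi mY.
  - by move=> w _; apply: I0; [exact: divp0|exact: divm0].
  apply: filterS ae_good => w [Ow gw] _; rewrite /I indE.
  have phiY : X w != 0 -> phi (Y w) = (Fmean (S w))%:E.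
    move=> Xn0; have VQ := valuesY_good Ow gw Xn0.
    rewrite (absprod_neq0 hX gw)//= phiE//.
    have [cE eE] := pair_good Ow gw Xn0.
    have [[X0 _]|[hm _]] := good_cases hX gw; first by rewrite X0 eqxx in Xn0.
    have mh := qminus_gt0 hX hm.
    rewrite /two_point_mean gt_eqF ?qprod_gt0// cE eE normrN gtr0_norm//.
    congr EFin; rewrite /Fmean !mulrA -mulrDl.
    by rewrite [_ * qminus _ _]mulrC [_ * qplus _ _]mulrC.
  have [[X0 -> ->]|[X0 -> ->]|[X0 -> ->]] := funrpos_opp_sign w.
  - rewrite absprod_eq0//= X0 eqxx !mulr0 !add0r mulr1 phiE; last exact: pair_zero X0.
    by rewrite /two_point_mean eqxx.
  - have [hm Xw _] := recip_gt0 hX gw X0.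
    rewrite phiY ?gt_eqF//= !mulr0 !addr0 Xw divfK//.
    by rewrite gt_eqF// qplus_gt0.
  - have [hm Xw _] := recip_lt0 hX gw X0.
    rewrite phiY ?lt_eqF//= !mulr0 !(addr0, add0r) Xw opprK divfK//.
    by rewrite gt_eqF// qminus_gt0.
rewrite [LHS](integral_levels (mdivp _ mFplus) (mdivm _ mFminus)
  (divp0 _ Fp0) (divm0 _ Fm0) (F0 (0, 0))).
rewrite [RHS](integral_levels (mdivp _ mFmean) (mdivm _ mFmean)
  (divp0 _ Fmean0) (divm0 _ Fmean0) (F0 (0, 0))).
congr (_ + _)%E.
have mint (u v : R -> R) : measurable_fun [set: R] u -> measurable_fun [set: R] v ->
    measurable_fun [set: T] (fun w => ((u (S w) + v (S w)) * X^\+ w)%:E).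
  move=> mu mv; apply/measurable_EFinP; apply: measurable_funM => //.
  by apply: measurable_funD; [exact: measurableT_comp mu mS|exact: measurableT_comp mv mS].
apply: ge0_ae_eq_integral => //.
- exact: mint (mdivp _ mFplus) (mdivm _ mFminus).
- exact: mint (mdivp _ mFmean) (mdivm _ mFmean).
- by move=> w _; rewrite lee_fin mulr_ge0 ?funrpos_ge0// addr_ge0// divr_ge0.
- by move=> w _; rewrite lee_fin mulr_ge0 ?funrpos_ge0// addr_ge0// divr_ge0.
apply: filterS ae_good => w [_ gw] _.
have [[X0 -> _]|[X0 _ _]|[X0 -> _]] := funrpos_opp_sign w.
- by rewrite !mulr0.
- have [hm _ _] := recip_gt0 hX gw X0.
  have [ph mh] := (qplus_gt0 hX hm, qminus_gt0 hX hm).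
  congr (_ * _)%:E; rewrite /Fmean; field.
  by rewrite !gt_eqF// addr_gt0.
- by rewrite !mulr0.
Qed.

Lemma pushforward_disintegration :
  (\int[pushforward P Y]_(y in [set: R]) phi y = \int[P]_w phi (Y w))%E /\
  (\int[pushforward P Y]_(y in `[0%R, +oo[) phi y = \int[P]_w phi (Y w))%E.
Proof.
have mY := measurable_Y.
split.
  by rewrite ge0_integral_pushforward.
rewrite ge0_integral_pushforward//; last exact: measurable_funTS.
suff -> : Y @^-1` `[0, +oo[ = setT by [].
by apply/seteqP; split => // w _; rewrite /= in_itv/= andbT fine_ge0//; exact: abse_ge0.
Qed.

End disintegration_formula.

Lemma two_point_pair y d' (T' : measurableType d') (P' : probability T' R)
    (D : {RV P' >-> R}) : V0 y -> two_point P' y (c y) (e y) D ->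
  {ae P', forall w, D w = c y \/ D w = e y} /\
  forall G : R -> R, measurable_fun [set: R] G ->
    ('E_P'[fun w => G (D w)] =
      (if y == 0 then G 0 else
       G (e y) * (`|c y| / (`|c y| + e y)) + G (c y) * (e y / (`|c y| + e y)))%:E)%E.
Proof.
move=> Vy [Dn0 D0]; have [y0|yn0] := eqVneq y 0.
  split.
    have /eqP : - c y * e y = 0 by rewrite (pair_product Vy).
    rewrite mulNr oppr_eq0 mulf_eq0 => /orP[]/eqP H; apply: nearW => w.
      by rewrite D0// H; left.
    by rewrite D0// H; right.
  move=> G mG; rewrite unlock (eq_integral (cst (G 0)%:E)).
    by rewrite integral_cst// [X in (_ * X)%E]probability_setT mule1.
  by move=> w _; rewrite D0.
have /andP[c0 e0] := pair_sign Vy yn0; have [Pe Pc] := Dn0 yn0.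
have ce : c y != e y by rewrite lt_eqF// (lt_trans c0).
have pq : `|c y| / (`|c y| + e y) + e y / (`|c y| + e y) = 1.
  by rewrite -mulrDl divff// gt_eqF// ltr_wpDl.
split; first exact: two_points_ae ce pq Pe Pc.
move=> G mG; exact: expectation_two_points ce pq Pe Pc _ mG.
Qed.

Lemma two_point_mean_extension (F : R * R -> R) :
  measurable_fun [set: R * R] F -> (forall z, 0 <= F z) ->
  exists phi : R -> R, [/\ measurable_fun [set: R] phi, forall y, 0 <= phi y &
    forall y, V0 y -> phi y = two_point_mean F y].
Proof.
move=> mF F0.
have [c' mc' c'E] : exists2 g : R -> R, measurable_fun [set: R] g &
    forall y, V0 y -> g y = - c y.
  by apply: monotone_extension => y z Vy Vz /(dp_monotone dp Vy Vz)[].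
have [e' me' e'E] : exists2 g : R -> R, measurable_fun [set: R] g &
    forall y, V0 y -> g y = e y.
  by apply: monotone_extension => y z Vy Vz /(dp_monotone dp Vy Vz)[].
have mnc : measurable_fun [set: R] (fun y => `|c' y|) by exact: measurableT_comp.
have mne : measurable_fun [set: R] (fun y => `|e' y|) by exact: measurableT_comp.
have mw : measurable_fun [set: R] (fun y => `|c' y| + `|e' y|).
  exact: measurable_funD.
have mFe : measurable_fun [set: R] (fun y => F (e' y, y)).
  by apply: measurableT_comp mF _; exact: measurable_fun_pair.
have mFc : measurable_fun [set: R] (fun y => F (- c' y, y)).
  apply: measurableT_comp mF _; apply: measurable_fun_pair => //.
  exact: measurableT_comp.
exists (fun y => if y == 0 then F (0, 0) else
  F (e' y, y) * (`|c' y| / (`|c' y| + `|e' y|)) +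
  F (- c' y, y) * (`|e' y| / (`|c' y| + `|e' y|))); split.
- apply: measurable_fun_ifT => //; first exact: measurable_fun_eqr.
  by apply: measurable_funD; apply: measurable_funM => //;
    apply: measurable_fun_div => // y; rewrite addr_ge0.
- move=> y; case: ifP => // _.
  by rewrite addr_ge0// mulr_ge0// divr_ge0// addr_ge0.
- move=> y Vy; rewrite /two_point_mean; case: ifP => // _.
  have [c0 e0] := dp_sign dp Vy.
  by rewrite c'E// e'E// normrN opprK (ger0_norm e0).
Qed.

End conditional_law.

Theorem theorem2p2 (disp : measure_display) (T : measurableType disp)
    (R : realType) (P : probability T R) (X U : {RV P >-> R})
    (hX : zero_mean P X) (hU : uniform01 U) (hXU : independent_RV P X U) :
  (exists (O : set T) (c d : R -> R), disintegrating_pair P X U O c d) /\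
  measurable_fun [set: T] (absprod P X U) /\
  (forall (O : set T) (c d : R -> R), disintegrating_pair P X U O c d ->
   forall (dispD : R -> measure_display)
     (TD : forall y : R, measurableType (dispD y))
     (PD : forall y : R, probability (TD y) R)
     (D : forall y : R, {RV (PD y) >-> R}),
   (forall y, valuesY P X U O y -> two_point (PD y) y (c y) (d y) (D y)) ->
   (forall y, valuesY P X U O y ->
      {ae PD y, forall w, D y w = c y \/ D y w = d y} /\
      ('E_(PD y)[D y] = 0)%E) /\
   (forall F : R * R -> R, measurable_fun [set: R * R] F ->
      (forall z, 0 <= F z) ->
      let extends (phi : R -> \bar R) :=
        [/\ measurable_fun [set: R] phi, forall y, (0 <= phi y)%E &
            forall y, valuesY P X U O y ->
              (phi y = 'E_(PD y)[fun w => F (D y w, y)])%E] in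
      let Y := fun w => fine (absprod P X U w) in
      (exists phi, extends phi) /\
      (forall phi, extends phi ->
         ('E_P[fun w => F (X w, Y w)] =
           \int[pushforward P Y]_(y in [set: R]) phi y)%E /\
         ('E_P[fun w => F (X w, Y w)] =
           \int[pushforward P Y]_(y in `[0%R, +oo[) phi y)%E))).
Proof.
split.
  exists (base_event X U), (fun y => - nctilde X y), (dtilde X).
  exact: disintegrating_pair_base.
split; first exact: measurable_absprod.
move=> O c e dp dispD TD PD D hD; split.
  move=> y Vy; have [aeD ED] := two_point_pair dp Vy (hD y Vy).
  split; first exact: aeD.
  have mid : measurable_fun [set: R] (@idfun R) by exact: measurable_id.
  rewrite [LHS](ED _ mid) /=; have [//|yn0] := eqVneq y 0.
  have /andP[c0 e0] := pair_sign dp Vy yn0; congr EFin.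
  by rewrite ltr0_norm// !mulrA -mulrDl mulrN [c y * _]mulrC addNr mul0r.
move=> F mF F0 extends Y.
have EF y : valuesY P X U O y ->
    ('E_(PD y)[fun w => F (D y w, y)] = (two_point_mean c e F y)%:E)%E.
  move=> Vy; have [_ /(_ (fun x => F (x, y)))-> //] := two_point_pair dp Vy (hD y Vy).
    by rewrite /two_point_mean; case: eqP => [->|].
  by apply: measurableT_comp mF _; exact: measurable_fun_pair.
split.
  have [phi [mphi phi0 phiE]] := two_point_mean_extension dp mF F0.
  exists (EFin \o phi); split.
  - exact/measurable_EFinP.
  - by move=> y; rewrite lee_fin.
  - by move=> y Vy; rewrite /= phiE// EF.
move=> phi [mphi phi0 phiE].
have phiE' y : valuesY P X U O y -> phi y = (two_point_mean c e F y)%:E.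
  by move=> Vy; rewrite phiE// EF.
have [pT pi] := pushforward_disintegration hX hU hXU mphi phi0.
have := expectation_disintegration hX hU hXU dp mF F0 mphi phi0 phiE'.
by move=> EFY; split; [rewrite EFY pT|rewrite EFY pi].
Qed.
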